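(* Let $d_{\mathrm{sv}}=\min(m,k)\ge3$, $p=1+\frac1{\ln(d_{\mathrm{sv}})}$, $q=\frac p{p-1}$. Consider the closed-loop system, for $t\in\mathbb{Z}_+$, $$X_{t+1}=\mathcal{A}(X_t)+\mathcal{B}\bigl(\Theta\Psi(X_t,t)+U_t\bigr),\qquad U_t=-\mathcal{K}(X_t)-\widehat{\Theta}_t\Psi(X_t,t)+U_t^{\mathrm d},$$ with arbitrary initial state $X_0\in\mathbb{R}^{n_1\times n_2}$, where $\widehat\Theta_0=0$ and $$\widehat{\Theta}_{t+1}=\nabla f^*_{\mathrm{S}_p}\bigl(\nabla f_{\mathrm{S}_p}(\widehat{\Theta}_t)-\eta_{t+1}\nabla J_t(\widehat{\Theta}_t)\bigr),\qquad \eta_{t+1}=\frac{2J_t(\widehat{\Theta}_t)}{\epsilon_{t+1}+\|\nabla J_t(\widehat{\Theta}_t)\|_{\mathrm{S}_\infty}^2},$$ for a nonnegative bounded sequence $\{\epsilon_{t+1}\}_{t\in\mathbb{Z}_+}$. Suppose that $\Theta\in\mathbb{R}^{m\times k}$ has rank at most $s$, where $s$ is a positive integer. Then for every integer $T\ge1$ the regret $\operatorname{Reg}(T):=\sum_{t=0}^{T-1}J_t(\widehat\Theta_t)$ satisfies $$\operatorname{Reg}(T)\le\frac e2\,s^{\frac{\ln(d_{\mathrm{sv}})}{1+\ln(d_{\mathrm{sv}})}}\,\|\Theta\|_{\mathrm{S}_\infty}\sqrt{\ln(d_{\mathrm{sv}})\sum_{t=0}^{T-1}\left(\epsilon_{t+1}+\|\nabla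 J_t(\widehat\Theta_t)\|_{\mathrm{S}_\infty}^2\right)} .$$
   Context: Fix positive integers $n_1,n_2,m,k$. Matrix spaces carry the Frobenius inner product $\langle X,Y\rangle=\operatorname{Tr}(X^\top Y)$ and Frobenius norm $\|\cdot\|_{\mathrm F}$. $\mathcal{A}:\mathbb{R}^{n_1\times n_2}\to\mathbb{R}^{n_1\times n_2}$, $\mathcal{B}:\mathbb{R}^{m\times n_2}\to\mathbb{R}^{n_1\times n_2}$ and $\mathcal{K}:\mathbb{R}^{n_1\times n_2}\to\mathbb{R}^{m\times n_2}$ are linear operators such that $\mathcal{A}-\mathcal{B}\mathcal{K}$ (i.e. $X\mapsto\mathcal{A}(X)-\mathcal{B}(\mathcal{K}(X))$) is Schur stable (spectral radius $<1$). $\mathcal{B}^\top$ is the adjoint of $\mathcal{B}$: $\langle\mathcal{B}(U),V\rangle=\langle U,\mathcal{B}^\top(V)\rangle$. $\Psi:\mathbb{R}^{n_1\times n_2}\times\mathbb{Z}_+\to\mathbb{R}^{k\times n_2}$ is a map (the regressor), $\{U_t^{\mathrm d}\}_{t\in\mathbb{Z}_+}\subset\mathbb{R}^{m\times n_2}$ is a bounded sequence, and $\Theta\in\mathbb{R}^{m\times k}$ is the fixed true parameter. Residual, loss and gradient: $$\widetilde X_{t+1}:=X_{t+1}-(\mathcal{A}-\mathcal{B}\mathcal{K})(X_t)-\mathcal{B}(U_t^{\mathrm d})=\mathcal{B}\bigl((\Theta-\widehat\Theta_t)\Psi(X_t,t)\bigr),$$ $$J_t(\widehat\Theta_t):=\tfrac12\bigl\|\mathcal{B}\bigl((\Theta-\widehat\Theta_t)\Psi(X_t,t)\bigr)\bigr\|_{\mathrm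 F}^2=\tfrac12\|\widetilde X_{t+1}\|_{\mathrm F}^2,\qquad \nabla J_t(\widehat\Theta_t)=-\mathcal{B}^\top(\widetilde X_{t+1})\Psi(X_t,t)^\top .$$ $\|Q\|_{\mathrm{S}_r}$ is the Schatten $r$-norm (the $\ell_r$-norm of the singular values of $Q$); $\|\cdot\|_{\mathrm{S}_\infty}$ is the spectral norm. The mirror map is $f_{\mathrm{S}_p}(Q)=\frac{d_{\mathrm{sv}}^{2-2/p}}{2(p-1)}\|Q\|_{\mathrm{S}_p}^2$ on $\mathbb{R}^{m\times k}$, with Fenchel conjugate $f_{\mathrm{S}_p}^*$; explicitly, with singular value decompositions $Q=U\Sigma V^\top$ and $Z=\bar U\bar\Sigma\bar V^\top$, $$\nabla f_{\mathrm{S}_p}(Q)=\frac{d_{\mathrm{sv}}^{2-2/p}}{p-1}\|Q\|_{\mathrm{S}_p}^{2-p}\,U\Sigma^{p-1}V^\top,\qquad \nabla f_{\mathrm{S}_p}^*(Z)=\frac{p-1}{d_{\mathrm{sv}}^{2-2/p}}\|Z\|_{\mathrm{S}_q}^{2-q}\,\bar U\bar\Sigma^{q-1}\bar V^\top,$$ where powers act on the singular values and both gradients equal $0$ at $0$. Convention: if the denominator in the step size is zero (in which case $J_t(\widehat\Theta_t)=0$ too), set $\eta_{t+1}=0$. *)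

(* Defs.v *)
From mathcomp Require Import all_boot all_order all_algebra.
From mathcomp Require Import complex.
From mathcomp Require Import all_classical all_reals all_analysis.

Set Implicit Arguments.
Unset Strict Implicit.
Unset Printing Implicit Defensive.

Import Order.TTheory GRing.Theory Num.Theory.
Import numFieldNormedType.Exports.

Local Open Scope classical_set_scope.
Local Open Scope ring_scope.

Definition frob_inner (R : realType) (m n : nat) (X Y : 'M[R]_(m, n)) : R :=
  \tr (X^T *m Y).

Definition frob_norm (R : realType) (m n : nat) (X : 'M[R]_(m, n)) : R :=
  Num.sqrt (frob_inner X X).

Definition spectrum (R : realType) (m n : nat)
    (f : 'M[R]_(m, n) -> 'M[R]_(m, n)) : set R[i] :=
  [set z | eigenvalue (map_mx (real_complex R) (lin_mx f)) z].

Definition spectral_radius (R : realType) (m n : nat)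
    (f : 'M[R]_(m, n) -> 'M[R]_(m, n)) : R :=
  sup [set ComplexField.Normc.normc z | z in spectrum f].

Definition schur_stable (R : realType) (m n : nat)
    (f : 'M[R]_(m, n) -> 'M[R]_(m, n)) : Prop :=
  spectral_radius f < 1.

(* The singular values of Q (m x n) are the square roots of the eigenvalues of
   Q^T Q, with multiplicity.  There are n of them here: the min(m, n) usual ones
   plus, when m < n, n - m extra zeros, which change neither the Schatten
   r-norms (r > 0) nor the spectral norm.  Q^T Q is mapped to R[i] because
   spectral_diag is defined over a numClosedFieldType. *)
Definition singular_values (R : realType) (m n : nat) (Q : 'M[R]_(m, n)) :
    'rV[R]_n :=
  \row_i Num.sqrt
    (complex.Re (spectral_diag (map_mx (real_complex R) (Q^T *m Q)) 0 i)).

Definition schatten_norm (R : realType) (m n : nat) (r : R) (Q : 'M[R]_(m, n)) :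
    R :=
  (\sum_(i < n) singular_values Q 0 i `^ r) `^ r^-1.

Definition spectral_norm (R : realType) (m n : nat) (Q : 'M[R]_(m, n)) : R :=
  \big[Num.max/0]_(i < n) singular_values Q 0 i.

(* Gradient with respect to the Frobenius inner product, i.e. the matrix of
   partial derivatives. *)
Definition gradient (R : realType) (m n : nat) (f : 'M[R]_(m, n) -> R)
    (Q : 'M[R]_(m, n)) : 'M[R]_(m, n) :=
  \matrix_(i, j) 'D_(delta_mx i j) f Q.

(* The supremum is taken in R, so this is the conjugate only where it is
   finite; it is finite everywhere for a supercoercive continuous f such as
   mirror_map. *)
Definition fenchel_conj (R : realType) (m n : nat) (f : 'M[R]_(m, n) -> R)
    (Z : 'M[R]_(m, n)) : R :=
  sup [set frob_inner Z Q - f Q | Q in [set: 'M[R]_(m, n)]].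

Definition mirror_map (R : realType) (m k : nat) (p : R) (Q : 'M[R]_(m, k)) :
    R :=
  (minn m k)%:R `^ (2 - 2 / p) / (2 * (p - 1)) * schatten_norm p Q ^+ 2.

Definition loss (R : realType) (n1 n2 m k : nat)
    (B : 'M[R]_(m, n2) -> 'M[R]_(n1, n2)) (Theta : 'M[R]_(m, k))
    (Psi : 'M[R]_(k, n2)) (Q : 'M[R]_(m, k)) : R :=
  2^-1 * frob_norm (B ((Theta - Q) *m Psi)) ^+ 2.

Definition step_denominator (R : realType) (m k : nat) (eps : R)
    (G : 'M[R]_(m, k)) : R :=
  eps + spectral_norm G ^+ 2.

Definition step_size (R : realType) (m k : nat) (eps : R) (J : R)
    (G : 'M[R]_(m, k)) : R :=
  if step_denominator eps G == 0 then 0 else 2 * J / step_denominator eps G.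

(* Main.v *)
Require Import Defs.
From HB Require Import structures.
From mathcomp Require Import all_boot all_order all_algebra.
From mathcomp Require Import complex ring lra.
From mathcomp Require Import all_classical all_reals all_analysis.

(** The argument is the potential argument for mirror descent.  Let f be the
    mirror map and D_t the Bregman divergence of f between Theta and the t-th
    estimate.  Each loss is half the squared norm of a linear function of
    Theta - Q, so that <grad J_t, Theta - Q> = - 2 J_t.  As f is strongly convex
    with modulus 1 for the trace norm, a step of length eta changes the
    divergence by at most - 2 eta J_t + eta^2 |grad J_t|^2 / 2, the norm being
    the spectral norm [mirror_step_bregman].  With the given eta this reads
    2 J_t^2 <= (D_t - D_(t+1)) (eps_(t+1) + |grad J_t|^2) [mirror_step_loss].
    Summing up and using Cauchy-Schwarz, the squared regret is at most
    D_0 / 2 = f(Theta) / 2 times the sum of the denominators, and f(Theta) is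
    estimated by the rank and the spectral norm of Theta
    [mirror_map_low_rank]; the choice of p makes d^(2 - 2/p) at most e^2 and
    1 / (p - 1) equal to ln d.

    The heart of the matter is strong convexity with this sharp modulus
    [mirror_map_strongly_convex].  It is stated without the trace norm: for
    every W, <W, M - H>^2 is at most 2 |W|^2 times the divergence between M and
    H.  A rectangular matrix Q is replaced by the symmetric matrix
    [[0, Q], [Q^T, 0]], its dilation, which has the eigenvalues +-sigma_j(Q)
    [sum_dilation].  For two symmetric matrices with eigenvalues a_i, b_j and
    eigenbases u_i, v_j, every trace occurring here is a double sum weighted by
    the squared overlaps <u_i, v_j>^2, so that trace inequalities follow from
    scalar ones in a_i and b_j [eigenbasis_bregman], with no perturbation theory
    of eigenvalues.  The scalar inequality is a lower bound on the secant slopes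
    of x |x|^(p - 2) [sgpow_secant].  Combined with Cauchy-Schwarz it gives
    strong monotonicity of the gradient of the sum of the p-th powers of the
    singular values [schatten_grad_strong], with a constant depending on the
    larger of the two sums; for the gradient of f it yields the sharp modulus up
    to a factor that tends to 1 when the two matrices get close, which is enough
    along a segment [locally_strongly_increasing], [riemann_lower_bound].

    All gradients are found by one principle [convex_gradient]: if G is a
    choice of subgradients of a convex function, and G is continuous along
    lines, then G is its gradient.  For the Fenchel conjugate of f the choice is
    the maximizer, which exists by compactness and moves in a Lipschitz way by
    strong convexity; hence grad f inverts grad f^* [mirror_grad_fenchel],
    without any formula for f^*. *)

Set Implicit Arguments.
Unset Strict Implicit.
Unset Printing Implicit Defensive.

Import Order.TTheory GRing.Theory Num.Theory.
Import numFieldNormedType.Exports.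

Local Open Scope ring_scope.

(** * The real spectral theorem *)

Lemma mulmx_tr_ge0 (R : realType) n (v : 'rV[R]_n) : 0 <= (v *m v^T) 0 0.
Proof. by rewrite mxE sumr_ge0 // => i _; rewrite mxE -expr2 sqr_ge0. Qed.

Lemma mulmx_tr_eq0 (R : realType) n (v : 'rV[R]_n) :
  (v *m v^T) 0 0 = 0 -> v = 0.
Proof.
rewrite mxE => /eqP; rewrite psumr_eq0; last first.
  by move=> i _; rewrite mxE -expr2 sqr_ge0.
move=> /allP h; apply/rowP => i; have := h i (mem_index_enum _).
by rewrite /= !mxE -expr2 sqrf_eq0 => /eqP.
Qed.

Lemma realsym_complex_hermsym (R : realType) n (H : 'M[R]_n) : H^T = H ->
  map_mx (real_complex R) H \is hermsymmx.
Proof.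
move=> Hsym; apply: realsym_hermsym.
  by apply/is_hermitianmxP; rewrite expr0 scale1r; apply/matrixP => i j;
  rewrite !mxE /= -{1}Hsym mxE.
apply/mxOverP => i j; rewrite mxE.
by rewrite complex_real.
Qed.

Lemma char_poly_diagonalized (F : fieldType) n (P : 'M[F]_n) (d : 'rV_n) :
  P \in unitmx ->
  char_poly (invmx P *m diag_mx d *m P) = \prod_i ('X - (d 0 i)%:P).
Proof.
move=> Pu.
have -> : \prod_i ('X - (d 0 i)%:P) = char_poly (diag_mx d).
  rewrite char_poly_trig ?diag_mx_is_trig //.
  by apply: eq_bigr => i _; rewrite mxE eqxx mulr1n.
rewrite /char_poly.
have -> : char_poly_mx (invmx P *m diag_mx d *m P) =
    map_mx polyC (invmx P) *m char_poly_mx (diag_mx d) *m map_mx polyC P.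
  rewrite /char_poly_mx mulmxBr mulmxBl !map_mxM /=; congr (_ - _).
  by rewrite scalar_mxC -mulmxA -map_mxM mulVmx // map_mx1 mulmx1.
by rewrite !det_mulmx mulrAC -det_mulmx -map_mxM mulVmx // map_mx1 det1 mul1r.
Qed.

(** The complex matrix has an eigenvalue, which is real because the matrix is
    hermitian; so it is a root of the real characteristic polynomial and has a
    real eigenvector. *)
Lemma realsym_eigenvector (R : realType) n (H : 'M[R]_n.+1) : H^T = H ->
  exists (v : 'rV[R]_n.+1) (a : R), v *m H = a *: v /\ v *m v^T = 1%:M.
Proof.
move=> Hsym; set C := real_complex R.
have Hherm := realsym_complex_hermsym Hsym.
have /mxOverP/(_ 0 0) dreal := hermitian_spectral_diag_real Hherm.
have /hermitian_normalmx/orthomx_spectralP HE := Hherm.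
have /complex_realP[a da] := dreal.
have : eigenvalue H a.
  rewrite eigenvalue_root_char -(fmorph_root C) map_char_poly HE.
  rewrite char_poly_diagonalized ?spectral_unit //.
  rewrite -(big_map (spectral_diag (map_mx C H) 0) predT (fun x => 'X - x%:P)).
  rewrite root_prod_XsubC -/C.
  by apply/mapP; exists 0; rewrite ?mem_index_enum.
move=> /eigenvalueP[v vH v0].
have vv0 : 0 < (v *m v^T) 0 0.
  rewrite lt_def mulmx_tr_ge0 andbT; apply: contraNneq v0 => /mulmx_tr_eq0 ->.
  by rewrite eqxx.
exists ((Num.sqrt ((v *m v^T) 0 0))^-1 *: v), a; split.
  by rewrite -scalemxAl vH !scalerA mulrC.
rewrite linearZ /= -scalemxAl -scalemxAr scalerA -invfM -expr2 sqr_sqrtr ?ltW //.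
apply/matrixP => i j; rewrite !ord1 [LHS]mxE mulVf ?gt_eqF //.
by rewrite mxE eqxx.
Qed.

(** P is the reflection in the hyperplane orthogonal to the difference of v and
    the first basis vector, or the identity if they agree. *)
Lemma householder (R : realType) n (v : 'rV[R]_n.+1) : v *m v^T = 1%:M ->
  exists P : 'M[R]_n.+1,
    [/\ P^T = P, P *m P = 1%:M & delta_mx 0 0 *m P = v].
Proof.
move=> vv; set e : 'rV[R]_n.+1 := delta_mx 0 0.
have ee : e *m e^T = 1%:M.
  by rewrite trmx_delta mul_delta_mx; apply/matrixP => i j; rewrite !ord1 !mxE.
have [<-|ve] := eqVneq e v.
  by exists 1%:M; rewrite trmx1 !mulmx1.
set w := v - e; set c := (v *m e^T) 0 0.
have vec : v *m e^T = c%:M by rewrite [LHS]mx11_scalar.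
have evc : e *m v^T = c%:M.
  by rewrite -[LHS]trmxK trmx_mul trmxK vec tr_scalar_mx.
have ww : w *m w^T = (2 - 2 * c)%:M.
  rewrite /w linearB /= mulmxBr !mulmxBl vv ee vec evc -!raddfB /=.
  by congr (_%:M); ring.
have ew : e *m w^T = (c - 1)%:M.
  by rewrite /w linearB /= mulmxBr ee evc -raddfB.
have c1 : 1 - c != 0.
  apply: contraNneq ve => c1.
  have /mulmx_tr_eq0/eqP : (w *m w^T) 0 0 = 0 by rewrite ww mxE eqxx mulr1n; lra.
  by rewrite subr_eq0 eq_sym.
exists (1%:M - (1 - c)^-1 *: (w^T *m w)); split.
- by rewrite linearB linearZ /= trmx1 trmx_mul trmxK.
- have : (w^T *m w) *m (w^T *m w) = (2 - 2 * c) *: (w^T *m w).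
    by rewrite mulmxA -(mulmxA w^T) ww mul_mx_scalar -scalemxAl.
  move: (w^T *m w) => W WW.
  rewrite mulmxBr !mulmxBl !mul1mx !mulmx1 -scalemxAl -scalemxAr WW.
  by apply/matrixP => i j; rewrite !mxE; field.
- rewrite mulmxBr mulmx1 -scalemxAr mulmxA ew mul_scalar_mx scalerA.
  have -> : (1 - c)^-1 * (c - 1) = -1 by field.
  by rewrite scaleN1r opprK /w addrC subrK.
Qed.

(** Induction on the size: conjugation by a reflection that sends a unit
    eigenvector to the first basis vector splits off a block of size 1. *)
Theorem real_spectral (R : realType) n (H : 'M[R]_n) : H^T = H ->
  exists (O : 'M[R]_n) (a : 'rV[R]_n),
    O *m O^T = 1%:M /\ H = O^T *m diag_mx a *m O.
Proof.
elim: n H => [|n IHn] H Hsym.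
  by exists 1%:M, 0; split; apply/matrixP => -[].
have [v [l [vH vv]]] := realsym_eigenvector Hsym.
have [P [Psym PP eP]] := householder vv.
have vP : v *m P = delta_mx 0 0 by rewrite -eP -mulmxA PP mulmx1.
set H' : 'M[R]_(1 + n) := P *m H *m P.
have H'sym : H'^T = H' by rewrite /H' !trmx_mul Hsym Psym mulmxA.
have eH' : (delta_mx 0 0 : 'rV[R]_(1 + n)) *m H' = l *: delta_mx 0 0.
  by rewrite /H' !mulmxA eP vH -scalemxAl vP.
have HE : H = P *m H' *m P.
  by rewrite /H' !mulmxA PP mul1mx -mulmxA PP mulmx1.
clearbody H'.
have H'0 (i j : 'I_(1 + n)) : i = 0%N :> nat -> H' i j = l *+ (j == 0%N :> nat).
  move=> i0; have -> : i = 0 by exact: val_inj.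
  have /rowP/(_ j) := eH'; rewrite -rowE !mxE eqxx /= => ->.
  by rewrite mulr_natr.
have H'E : H' = block_mx l%:M 0 0 (drsubmx H').
  rewrite -[LHS]submxK; congr block_mx; apply/matrixP => i j.
  - by rewrite !ord1 !mxE H'0.
  - by rewrite !ord1 !mxE H'0.
  - by rewrite !ord1 -H'sym !mxE H'0.
have [|O [a [OO dE]]] := IHn (drsubmx H').
  by rewrite trmx_drsub H'sym.
pose O1 : 'M[R]_n.+1 := block_mx (1%:M : 'M[R]_1) 0 0 O.
exists (O1 *m P), (row_mx (l%:M : 'M[R]_1) a : 'rV_(1 + n)); split.
  rewrite trmx_mul Psym mulmxA -(mulmxA O1 P P) PP mulmx1 /O1.
  rewrite (@tr_block_mx _ 1 n 1 n) !trmx0 trmx1 (@mulmx_block _ 1 n 1 n 1 n).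
  rewrite !mul1mx !mulmx0 !mul0mx !addr0 add0r OO.
  by rewrite -(@scalar_mx_block _ 1 n).
rewrite HE trmx_mul Psym -!mulmxA; congr (P *m _); rewrite !mulmxA.
congr (_ *m P); rewrite /O1 {1}H'E dE (@tr_block_mx _ 1 n 1 n).
rewrite (@diag_mx_row _ n 1) !trmx0 trmx1 !(@mulmx_block _ 1 n 1 n 1 n).
rewrite !(mul1mx, mulmx1, mulmx0, mul0mx, addr0, add0r).
suff -> : diag_mx (l%:M : 'M[R]_1) = l%:M by [].
by apply/matrixP => i j; rewrite !ord1 !mxE eqxx.
Qed.

(** * Singular values and dilations *)

(** Both sides are X^k times the determinant of the block matrix with rows (X, A)
    and (B, 1), by two block triangular factorizations. *)
Lemma char_poly_mulmxC (F : fieldType) m k (A : 'M[F]_(m, k)) (B : 'M[F]_(k, m)) :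
  'X ^+ k * char_poly (A *m B) = 'X ^+ m * char_poly (B *m A).
Proof.
pose a := map_mx polyC A; pose b := map_mx polyC B.
pose D := block_mx ('X%:M : 'M[{poly F}]_m) a b (1%:M : 'M[{poly F}]_k).
have D1 : \det D = char_poly (A *m B).
  have : D *m block_mx 1%:M 0 (- b) 1%:M = block_mx ('X%:M - a *m b) a 0 1%:M.
    rewrite mulmx_block !(mulmx1, mul1mx, mulmx0, add0r) !mulmxN addrC.
    by rewrite subrr addrC.
  move/(congr1 (fun M => \det M)); rewrite det_mulmx det_lblock det_ublock.
  by rewrite !det1 !mulr1 /char_poly /char_poly_mx map_mxM.
rewrite -D1 -[X in _ = X]/('X ^+ m * \det (char_poly_mx (B *m A))).
have : block_mx 1%:M 0 (- b) 'X%:M *m D = block_mx 'X%:M a 0 ('X%:M - b *m a).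
  rewrite mulmx_block !(mulmx1, mul1mx, mul0mx, addr0, mulNmx).
  by rewrite scalar_mxC addNr addrC.
move/(congr1 (fun M => \det M)); rewrite det_mulmx det_lblock det_ublock.
by rewrite det1 mul1r !det_scalar /char_poly_mx map_mxM.
Qed.

Section Dilation.
Variable R : realType.

(** The Jordan-Wielandt matrix: it lets the spectral calculus of symmetric
    matrices act on rectangular ones. *)
Definition dilation m k (Q : 'M[R]_(m, k)) : 'M[R]_(m + k) :=
  block_mx 0 Q Q^T 0.

Definition eigensystem n (H O : 'M[R]_n) (a : 'rV[R]_n) :=
  O *m O^T = 1%:M /\ H = O^T *m diag_mx a *m O.

Lemma dilation_sym m k (Q : 'M[R]_(m, k)) : (dilation Q)^T = dilation Q.
Proof. by rewrite tr_block_mx !trmx0 trmxK. Qed.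

Lemma dilation_eigensystem m k (Q : 'M[R]_(m, k)) :
  exists O a, eigensystem (dilation Q) O a.
Proof. exact: real_spectral (dilation_sym Q). Qed.

Lemma dilation_is_linear m k : linear (@dilation m k).
Proof.
move=> c P Q; rewrite /dilation scale_block_mx add_block_mx !scaler0 !addr0.
by rewrite linearP.
Qed.

HB.instance Definition _ m k :=
  GRing.isLinear.Build R 'M[R]_(m, k) 'M[R]_(m + k) *:%R (@dilation m k)
    (@dilation_is_linear m k).

Lemma singular_values_ge0 m k (Q : 'M[R]_(m, k)) i : 0 <= singular_values Q 0 i.
Proof. by rewrite mxE sqrtr_ge0. Qed.

Lemma spectral_diag_gram m k (Q : 'M[R]_(m, k)) i :
  spectral_diag (map_mx (real_complex R) (Q^T *m Q)) 0 i =
  (singular_values Q 0 i ^+ 2)%:C%C.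
Proof.
set M := map_mx _ _; set C := real_complex R.
have Msym : (Q^T *m Q)^T = Q^T *m Q by rewrite trmx_mul trmxK.
have Mherm : M \is hermsymmx by apply: realsym_complex_hermsym.
have /mxOverP/(_ 0 i)/RRe_real dE := hermitian_spectral_diag_real Mherm.
rewrite -dE /singular_values mxE -/M sqr_sqrtr // -lecR dE.
have /hermitian_normalmx/orthomx_spectralP := Mherm.
set P := spectralmx M; set D := spectral_diag M => ME.
have Pu : P \is unitarymx by exact: spectral_unitarymx.
have := congr1 (fun X => P *m X *m invmx P) ME.
rewrite !mulmxA mulmxV ?unitarymx_unit // mul1mx mulmxK ?unitarymx_unit //.
move=> /matrixP/(_ i i); rewrite [RHS]mxE eqxx mulr1n => <-.
have -> : M = map_mx C Q^T *m map_mx C Q by rewrite -map_mxM.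
rewrite invmx_unitary // mulmxA -mulmxA.
have -> : map_mx C Q *m map_mx Num.conj P^T =
    map_mx Num.conj (P *m map_mx C Q^T)^T.
  rewrite trmx_mul map_mxM; congr (_ *m _).
  by apply/matrixP => x y; rewrite !mxE; exact: (esym (conjc_real _)).
by rewrite mxE sumr_ge0 // => j _; rewrite !mxE mul_conjC_ge0.
Qed.

(** This carries the complex diagonalization behind the singular values over to
    a statement about real polynomials. *)
Lemma char_poly_gram m k (Q : 'M[R]_(m, k)) :
  char_poly (Q^T *m Q) =
  \prod_i ('X - (singular_values Q 0 i ^+ 2)%:P).
Proof.
apply: (@map_poly_inj _ _ (real_complex R)).
rewrite map_char_poly rmorph_prod /=.
have Msym : (Q^T *m Q)^T = Q^T *m Q by rewrite trmx_mul trmxK.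
have := realsym_complex_hermsym Msym.
move=> /hermitian_normalmx/orthomx_spectralP ->.
rewrite char_poly_diagonalized ?spectral_unit //; apply: eq_bigr => i _.
by rewrite rmorphB /= map_polyX map_polyC spectral_diag_gram.
Qed.

Lemma eigensystem_orth n (H O : 'M[R]_n) a :
  eigensystem H O a -> O^T *m O = 1%:M.
Proof. by case=> OO _; rewrite mulmx1C. Qed.

(** The square of the dilation is block diagonal with blocks Q Q^T and Q^T Q,
    whose characteristic polynomials agree up to powers of X.  Unique
    factorization then identifies the squares of the eigenvalues with two copies
    of the squared singular values up to zeros, on which h vanishes. *)
Lemma sum_dilation m k (Q : 'M[R]_(m, k)) O a (h : R -> R) :
  eigensystem (dilation Q) O a -> h 0 = 0 ->
  \sum_i h (a 0 i ^+ 2) = 2 * \sum_i h (singular_values Q 0 i ^+ 2).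
Proof.
move=> es h0; have OtO := eigensystem_orth es; case: es => OO SE.
pose a2 : 'rV[R]_(m + k) := \row_i a 0 i ^+ 2.
have S2 : dilation Q *m dilation Q = O^T *m diag_mx a2 *m O.
  rewrite SE !mulmxA -(mulmxA _ O) OO mulmx1 -(mulmxA O^T) mulmx_diag.
  by congr (_ *m diag_mx _ *m _); apply/rowP => i; rewrite !mxE expr2.
have Ou : O \in unitmx by case/mulmx1_unit: OO.
have OV : O^T = invmx O by rewrite -[LHS]mul1mx -(mulVmx Ou) -mulmxA OO mulmx1.
have c1 : char_poly (dilation Q *m dilation Q) =
    \prod_i ('X - (a 0 i ^+ 2)%:P).
  rewrite S2 OV char_poly_diagonalized //.
  by apply: eq_bigr => i _; rewrite mxE.
have c2 : char_poly (dilation Q *m dilation Q) =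
    char_poly (Q *m Q^T) * char_poly (Q^T *m Q).
  rewrite mulmx_block !(mulmx0, mul0mx, addr0, add0r).
  by rewrite /char_poly char_block_diag_mx det_ublock.
have := congr1 ( *%R ('X ^+ k)) c2; rewrite c1 mulrA.
rewrite char_poly_mulmxC char_poly_gram -mulrA.
rewrite -(big_map (fun i => a 0 i ^+ 2) predT (fun x => 'X - x%:P)).
rewrite -(big_map (fun i => singular_values Q 0 i ^+ 2) predT
  (fun x => 'X - x%:P)).
have Xn n : 'X^n = \prod_(x <- nseq n (0 : R)) ('X - x%:P).
  by rewrite big_nseq iter_mulr_1 subr0.
rewrite !Xn -!big_cat => /prod_XsubC_eq pe.
have sumE (s t : seq R) : perm_eq s t -> \sum_(x <- s) h x = \sum_(x <- t) h x.
  by move=> st; exact: perm_big.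
have := sumE _ _ pe.
have hz n : \sum_(x <- nseq n (0 : R)) h x = 0.
  by rewrite big_nseq h0 iter_addr_0 mul0rn.
by rewrite !big_cat /= !hz !add0r !big_map => ->; ring.
Qed.

End Dilation.

(** * Inequalities for real powers *)

Section PowerInequalities.
Variable R : realType.
Implicit Types (a b p q r t x y : R).

(** For r = p - 1 this is the derivative of |x|^p / p. *)
Definition sgpow r x : R := Num.sg x * `|x| `^ r.

Lemma sgpow_ge0 r x : 0 <= x -> r != 0 -> sgpow r x = x `^ r.
Proof.
rewrite le_eqVlt => /predU1P[<-|x0] r0; rewrite /sgpow.
  by rewrite sgr0 mul0r powR0.
by rewrite gtr0_sg // mul1r gtr0_norm.
Qed.

Lemma sgpowN r x : sgpow r (- x) = - sgpow r x.
Proof. by rewrite /sgpow sgrN normrN mulNr. Qed.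

Lemma sgpow0 r : sgpow r 0 = 0.
Proof. by rewrite /sgpow sgr0 mul0r. Qed.

Lemma mul_sgpow p x : p != 0 -> x * sgpow (p - 1) x = `|x| `^ p.
Proof.
move=> p0; rewrite /sgpow mulrA (mulrC x) -normrEsg.
have [->|x0] := eqVneq x 0; first by rewrite normr0 mul0r powR0.
rewrite -[X in X * _](@powRr1 _ `|x|) // -powRD; first by rewrite addrC subrK.
by rewrite normr_eq0 x0 implybT.
Qed.

(** Convexity of |x|^p, in the form of Young's inequality for
    |a|^(p - 1) |b|. *)
Lemma powR_bregman_ge0 p a b : 1 < p ->
  0 <= `|b| `^ p - `|a| `^ p - p * (sgpow (p - 1) a * (b - a)).
Proof.
move=> p1; have p0 : 0 < p by lra.
have pn0 : p != 0 by rewrite gt_eqF.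
rewrite mulrBr (mulrC _ a) mul_sgpow //.
have h1 : sgpow (p - 1) a * b <= `|a| `^ (p - 1) * `|b|.
  rewrite (le_trans (ler_norm _)) // normrM ler_wpM2r // /sgpow normrM.
  rewrite norm_powR // normr_id ler_piMl ?powR_ge0 // normr_sg.
  by case: (a != 0).
have q0 : 0 < p / (p - 1) by rewrite divr_gt0 //; lra.
have := @conjugate_powR _ (`|a| `^ (p - 1)) `|b| (p / (p - 1)) p.
move=> /(_ (powR_ge0 _ _) (normr_ge0 _) q0 p0).
rewrite invf_div -powRrM.
have -> : (p - 1) * (p / (p - 1)) = p by field; rewrite gt_eqF //; lra.
move=> /(_ _)/wrap[]; first by field.
move=> h2.
have : p * (sgpow (p - 1) a * b) <= p * (`|a| `^ p * ((p - 1) / p) + `|b| `^ p / p).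
  by rewrite ler_pM2l //; exact: le_trans h2.
have -> : p * (`|a| `^ p * ((p - 1) / p) + `|b| `^ p / p) =
   (p - 1) * `|a| `^ p + `|b| `^ p by field.
lra.
Qed.

(** Normalize the sum of x and y to 1 and use z <= z^r on [0, 1]. *)
Lemma powR_subadditive r x y : 0 < r <= 1 -> 0 <= x -> 0 <= y ->
  (x + y) `^ r <= x `^ r + y `^ r.
Proof.
move=> /andP[r0 r1] x0 y0.
have [xy0|xy0] := eqVneq (x + y) 0.
  by rewrite xy0 powR0 ?gt_eqF // addr_ge0 // powR_ge0.
have s0 : 0 < x + y by rewrite lt_def xy0 addr_ge0.
have key z : 0 <= z -> z <= x + y -> z / (x + y) <= z `^ r / (x + y) `^ r.
  rewrite le_eqVlt => /predU1P[<- _|z0 zs].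
    by rewrite mul0r powR0 ?gt_eqF // mul0r.
  have : z / (x + y) <= (z / (x + y)) `^ r.
    by apply: ger1_powR => //; rewrite divr_gt0 //= ler_pdivrMr // mul1r.
  have e : ((x + y)^-1) `^ r = ((x + y) `^ r)^-1.
    by rewrite -powR_inv1 ?ltW // -powRrM mulN1r powRN.
  by rewrite powRM ?invr_ge0 ?(ltW z0) ?(ltW s0) // e.
have /(lerD (key _ x0 _)) : y / (x + y) <= y `^ r / (x + y) `^ r.
  by apply: key; rewrite // lerDr.
move=> /(_ _)/wrap[]; first by rewrite lerDl.
by rewrite -!mulrDl divff // ler_pdivlMr ?powR_gt0 // mul1r.
Qed.

Lemma sgpow_holder r a b : 0 < r <= 1 ->
  `|sgpow r b - sgpow r a| <= 2 * `|b - a| `^ r.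
Proof.
move=> r01; have r0 : r != 0 by case/andP: r01 => ? _; rewrite gt_eqF.
have same x y : 0 <= x -> x <= y ->
    `|sgpow r y - sgpow r x| <= 2 * `|y - x| `^ r.
  move=> x0 xy; have y0 := le_trans x0 xy.
  rewrite !sgpow_ge0 // !ger0_norm ?subr_ge0 //; last first.
    by rewrite ge0_ler_powR ?nnegrE //; case/andP: r01 => /ltW.
  have := @powR_subadditive r (y - x) x r01.
  rewrite subr_ge0 subrK => /(_ xy x0); have := powR_ge0 (y - x) r; lra.
have opp x y : 0 <= x -> 0 <= y ->
    `|sgpow r y - sgpow r (- x)| <= 2 * `|y - (- x)| `^ r.
  move=> x0 y0; rewrite sgpowN !opprK !sgpow_ge0 // !ger0_norm ?addr_ge0 ?powR_ge0 //.
  have : y `^ r <= (y + x) `^ r.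
    by rewrite ge0_ler_powR ?nnegrE ?addr_ge0 ?lerDl //; case/andP: r01 => /ltW.
  have : x `^ r <= (y + x) `^ r.
    by rewrite ge0_ler_powR ?nnegrE ?addr_ge0 ?lerDr //; case/andP: r01 => /ltW.
  lra.
wlog ab : a b / a <= b => [hw|].
  have [|/ltW] := leP a b; first exact: hw.
  by move=> /hw; rewrite distrC (distrC b).
have [a0|a0] := leP 0 a; first exact: same.
have [b0|b0] := leP 0 b.
  by have := opp (- a) b _ b0; rewrite opprK; apply; rewrite oppr_ge0 ltW.
have := same (- b) (- a); rewrite !sgpowN !opprK oppr_ge0 lerN2 => /(_ (ltW b0) ab).
by rewrite ![- _ + _]addrC.
Qed.

(** Continuity at 0 is what matters: the weight in the gradient of the mirror
    map is a power with exponent in ]0, 1[ of a quantity that may vanish. *)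
Lemma continuous_powR_norm r : 0 < r -> continuous (fun x : R => `|x| `^ r).
Proof.
move=> r0 x; have [->|x0] := eqVneq x 0.
  rewrite /continuous_at normr0 powR0 ?gt_eqF //.
  apply/cvgrPdist_le => e e0; near=> t.
  rewrite sub0r normrN ger0_norm ?powR_ge0 //.
  have : `|t| <= e `^ r^-1.
    near: t; apply: (@nbhs0_le R R^o); exact: powR_gt0.
  move=> te; rewrite -[leRHS]powRr1 ?(ltW e0) // -(mulVf (lt0r_neq0 r0)) powRrM.
  by rewrite ge0_ler_powR ?nnegrE ?powR_ge0 // ltW.
have h1 : {for x, continuous (fun y : R => `|y|)} by exact: (@norm_continuous R R^o).
have h2 : continuous_at `|x| (fun y : R => y `^ r).
  apply/differentiable_continuous/derivable1_diffP.
  by apply: ex_derive; apply: is_derive1_powR; rewrite normr_gt0.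
exact: (continuous_comp h1 h2).
Unshelve. all: by end_near. Qed.

End PowerInequalities.

Section SecantInequality.
Variable R : realType.
Implicit Types (a b p q r t x y : R).

(** A concave power lies below its tangent at L. *)
Lemma powR_tangent r L x : 0 < r < 1 -> 0 < L -> 0 <= x ->
  x `^ r <= (1 - r) * L `^ r + r * L `^ (r - 1) * x.
Proof.
move=> /andP[r0 r1] L0 x0.
have r10 : 0 < (1 - r)^-1 by rewrite invr_gt0; lra.
have rV0 : 0 < r^-1 by rewrite invr_gt0.
have := @conjugate_powR _ (x `^ r) (L `^ (1 - r)) r^-1 (1 - r)^-1
  (powR_ge0 _ _) (powR_ge0 _ _) rV0 r10.
rewrite !invrK addrC subrK => /(_ erefl).
rewrite -!powRrM !divff ?gt_eqF ?subr_gt0 // !powRr1 ?(ltW L0) // => h.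
have LL : L `^ (1 - r) * L `^ (r - 1) = 1.
  by rewrite -opprB powRN mulVf // gt_eqF // powR_gt0.
have Lr : L * L `^ (r - 1) = L `^ r by rewrite mulr_powRB1 ?ltW.
have /(ler_wpM2r (powR_ge0 L (r - 1))) := h.
rewrite -(mulrA (x `^ r)) LL mulr1 => {}h.
have -> : (1 - r) * L `^ r = (1 - r) * (L * L `^ (r - 1)) by rewrite Lr.
lra.
Qed.

Lemma dual_exponent_bounds q r : 2 < q -> r = 1 - 2 / q -> 0 < r < 1.
Proof.
move=> q2 ->; have q0 : 0 < q by lra.
have h1 : 0 < 2 / q by rewrite divr_gt0.
have h2 : 2 / q < 1 by rewrite ltr_pdivrMr // mul1r.
by apply/andP; split; lra.
Qed.

(** The secant slope of z^(q - 1) is the mean over [x, y] of (q - 1) z^(q - 2).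
    By the tangent bound z^(q - 2) = (z^q)^r is at most an affine function of
    z^q, and the mean of the convex function z^q is at most the mean of its two
    end values.  The proof shows that the difference of the two sides increases
    with y. *)
Lemma powR_secant q r L x y : 2 < q -> r = 1 - 2 / q ->
  0 < L -> 0 <= x -> x <= y ->
  y `^ (q - 1) - x `^ (q - 1) <= (q - 1) * (y - x) *
    ((1 - r) * L `^ r + r * L `^ (r - 1) * ((x `^ q + y `^ q) / 2)).
Proof.
move=> q2 rE L0 x0; have r01 := dual_exponent_bounds q2 rE; rewrite le_eqVlt => /predU1P[<-|xy].
  by rewrite !subrr mulr0 mul0r.
set C1 := (1 - r) * L `^ r; set C2 := r * L `^ (r - 1).
have C20 : 0 <= C2.
  by rewrite /C2 mulr_ge0 ?powR_ge0 //; case/andP: r01 => /ltW.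
pose f := fun z : R => (q - 1) * ((z - x) * (C1 + C2 * ((x `^ q + z `^ q) / 2)))
  - z `^ (q - 1).
pose df := fun z : R => (q - 1) * (C1 + C2 * ((x `^ q + z `^ q) / 2) +
   (z - x) * (C2 * (q * z `^ (q - 1) / 2))) - (q - 1) * z `^ (q - 1 - 1).
have fdf z : z \in `]x, y[%R -> is_derive z 1 f (df z).
  rewrite in_itv /= => /andP[xz zy]; have z0 : 0 < z by apply: le_lt_trans xz.
  have d1 := is_derive1_powR q z0; have d2 := is_derive1_powR (q - 1) z0.
  rewrite /f /df; apply: is_derive_eq.
  by rewrite /GRing.scale /=; ring.
have fc : ({within `[x, y], continuous f})%classic.
  pose g := fun z : R => (q - 1) * ((z - x) * (C1 + C2 * ((x `^ q + `|z| `^ q) / 2)))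
    - `|z| `^ (q - 1).
  have gc : continuous g.
    move=> z; apply: cvgB; last by apply: continuous_powR_norm; lra.
    apply: cvgM; first exact: cvg_cst.
    apply: cvgM; first by apply: cvgB; [exact: cvg_id|exact: cvg_cst].
    apply: cvgD; first exact: cvg_cst.
    apply: cvgM; first exact: cvg_cst.
    apply: cvgM; last exact: cvg_cst.
    by apply: cvgD; [exact: cvg_cst|apply: continuous_powR_norm; lra].
  apply: (@subspace_eq_continuous _ _ _ g); last exact: continuous_subspaceT.
  move=> z; rewrite inE /= in_itv /= => /andP[xz _].
  by rewrite /g /f ger0_norm //; exact: le_trans xz.
have [c] := MVT xy fdf fc.
rewrite in_itv /= => /andP[xc cy] fE.
have c0 : 0 < c by apply: le_lt_trans xc.
have : 0 <= df c.
  rewrite /df -mulrBr mulr_ge0 //; first lra.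
  have /(powR_tangent r01 L0) : 0 <= c `^ q by exact: powR_ge0.
  rewrite -powRrM.
  have -> : q * r = q - 1 - 1 by rewrite rE; field; lra.
  have := @powR_bregman_ge0 _ q c x.
  rewrite sgpow_ge0 ?(ltW c0) //; last by rewrite gt_eqF //; lra.
  rewrite !ger0_norm ?(ltW c0) // => /(_ _)/wrap[]; first lra.
  rewrite -/C1 -/C2 => h1 h2.
  have := mulr_ge0 C20 h1; lra.
move=> dfc; have : 0 <= f y - f x.
  by rewrite fE mulr_ge0 // subr_ge0 ltW.
rewrite /f subrr mul0r mulr0 -/C1 -/C2; lra.
Qed.

(** For dual exponents the inverse of [sgpow (p - 1)] is [sgpow (q - 1)], so an
    upper bound on the slopes of the latter is a lower bound on the slopes of
    the former.  For arguments of opposite signs the bound at (0, y), where |y|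
    is the larger modulus, is already sufficient. *)
Lemma sgpow_secant p q r L a b :
  1 < p -> 2 < q -> p^-1 + q^-1 = 1 -> r = 1 - 2 / q -> 0 < L ->
  (p - 1) * (b - a) ^+ 2 <= (sgpow (p - 1) b - sgpow (p - 1) a) * (b - a) *
   ((1 - r) * L `^ r + r * L `^ (r - 1) * ((`|a| `^ p + `|b| `^ p) / 2)).
Proof.
move=> p1 q2 pq rE L0; have r01 := dual_exponent_bounds q2 rE.
have q0 : 0 < q by lra.
have p0 : 0 < p by lra.
have pE : p = q / (q - 1).
  have qp : p * q = p + q.
    have := pq; move/(congr1 ( *%R (p * q))).
    rewrite mulr1 => <-; field; apply/andP; split; lra.
  have q1 : q - 1 != 0 by rewrite gt_eqF //; lra.
  by apply: (mulIf q1); rewrite divfK //; lra.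
have p2 : p < 2.
  by rewrite pE ltr_pdivrMr; lra.
have p1E : p - 1 = (q - 1)^-1 by rewrite pE; field; lra.
have pp0 : p - 1 != 0 by rewrite subr_eq0 gt_eqF.
have qp1 (x : R) : 0 <= x -> (x `^ (p - 1)) `^ (q - 1) = x.
  by move=> x0; rewrite -powRrM p1E mulVf ?powRr1 //; lra.
have qp2 (x : R) : (x `^ (p - 1)) `^ q = x `^ p.
  by rewrite -powRrM; congr (_ `^ _); rewrite p1E pE mulrC.
have pos (x y : R) : 0 <= x -> x <= y ->
   (p - 1) * (y - x) ^+ 2 <= (sgpow (p - 1) y - sgpow (p - 1) x) * (y - x) *
   ((1 - r) * L `^ r + r * L `^ (r - 1) * ((`|x| `^ p + `|y| `^ p) / 2)).
  move=> x0 xy; have y0 := le_trans x0 xy.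
  rewrite !sgpow_ge0 // !ger0_norm //.
  have := @powR_secant q r L (x `^ (p - 1)) (y `^ (p - 1)) q2 rE L0 (powR_ge0 _ _) _.
  rewrite !qp1 // !qp2 => /(_ _)/wrap[].
    by rewrite ge0_ler_powR ?nnegrE //; lra.
  move=> h; rewrite expr2 mulrA [leRHS]mulrAC ler_wpM2r ?subr_ge0 //.
  rewrite [X in X * _ <= _]p1E ler_pdivrMl ?mulrA //; lra.
have mixed (x y : R) : 0 <= x -> x <= y ->
   (p - 1) * (y - (- x)) ^+ 2 <= (sgpow (p - 1) y - sgpow (p - 1) (- x)) * (y - (- x)) *
   ((1 - r) * L `^ r + r * L `^ (r - 1) * ((`|- x| `^ p + `|y| `^ p) / 2)).
  move=> x0 xy; have y0 := le_trans x0 xy.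
  have := pos 0 y (lexx 0) y0.
  rewrite sgpowN !opprK normrN !sgpow_ge0 // !ger0_norm // powR0 // !subr0.
  rewrite (powR0 (lt0r_neq0 p0)) add0r.
  set K0 := ((1 - r) * _ + _) => h0.
  set K1 := ((1 - r) * _ + _).
  have K01 : K0 <= K1.
    rewrite /K0 /K1 lerD2l ler_wpM2l //; last by rewrite ler_wpM2r ?invr_ge0 // lerDr powR_ge0.
    by rewrite mulr_ge0 ?powR_ge0 //; case/andP: r01 => /ltW.
  move: y0; rewrite le_eqVlt => /predU1P[y0|y0].
    have -> : x = 0 by apply/le_anti; rewrite x0 y0 xy.
    by rewrite -y0 addr0 expr0n mulr0 mulr0 mul0r.
  have xy1 : (y + x) * y `^ (p - 1) <= (x `^ (p - 1) + y `^ (p - 1)) * y.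
    have split_powR z : 0 < z -> z = z `^ (p - 1) * z `^ (2 - p).
      move=> z0; rewrite -powRD; last by rewrite (gt_eqF z0) implybT.
      by rewrite [p - 1 + _](_ : _ = 1) ?powRr1 ?(ltW z0) //; ring.
    move: x0; rewrite le_eqVlt => /predU1P[x0|x0].
      by rewrite -x0 addr0 powR0 // add0r mulrC.
    have : x * y `^ (p - 1) <= x `^ (p - 1) * y.
      rewrite {1}(split_powR x x0) {2}(split_powR y y0) mulrA mulrAC.
      rewrite ler_wpM2l ?mulr_ge0 ?powR_ge0 // ge0_ler_powR ?nnegrE ?(ltW y0) //.
        by rewrite subr_ge0 ltW.
      exact: ltW.
    by lra.
  have xy0 : 0 < y + x by rewrite ltr_wpDr.
  have h1 : (p - 1) * y <= y `^ (p - 1) * K0.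
    rewrite -(ler_pM2r y0); move: h0; rewrite expr2; lra.
  have K00 : 0 <= K0.
    have : 0 <= y `^ (p - 1) * K0 by apply: le_trans h1; rewrite mulr_ge0 ?ltW //; lra.
    by rewrite pmulr_rge0 // powR_gt0.
  have h2 : (p - 1) * (y + x) <= (y `^ (p - 1) + x `^ (p - 1)) * K1.
    rewrite -(ler_pM2r y0).
    have := ler_wpM2r K00 xy1; have := ler_wpM2l (ltW xy0) h1.
    have := ler_wpM2l (addr_ge0 (powR_ge0 y (p - 1)) (powR_ge0 x (p - 1))) K01.
    move=> /(ler_wpM2r (ltW y0)); lra.
  by have := ler_wpM2r (ltW xy0) h2; rewrite expr2; lra.
have neg x y : (p - 1) * (y - x) ^+ 2 <=
     (sgpow (p - 1) y - sgpow (p - 1) x) * (y - x) *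
     ((1 - r) * L `^ r + r * L `^ (r - 1) * ((`|x| `^ p + `|y| `^ p) / 2)) ->
   (p - 1) * (- x - - y) ^+ 2 <=
     (sgpow (p - 1) (- x) - sgpow (p - 1) (- y)) * (- x - - y) *
     ((1 - r) * L `^ r + r * L `^ (r - 1) * ((`|- y| `^ p + `|- x| `^ p) / 2)).
  rewrite !sgpowN !opprK !normrN (addrC (- x)) (addrC (- sgpow _ x)).
  by rewrite (addrC (`|y| `^ p)).
wlog ab : a b / a <= b => [hw|].
  have [|/ltW/hw] := leP a b; first exact: hw.
  rewrite -(opprB a) sqrrN -(opprB (sgpow _ a)) mulrNN.
  by rewrite (addrC (`|b| `^ p)).
have [a0|a0] := leP 0 a; first exact: pos.
have [b0|/ltW b0] := leP b 0.
  have := neg _ _ (pos (- b) (- a) _ _); rewrite !opprK; apply.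
    by rewrite oppr_ge0.
  by rewrite lerN2.
have na0 : 0 <= - a by rewrite oppr_ge0 ltW.
have [h|/ltW h] := leP (- a) b.
  by have := mixed _ _ na0 h; rewrite !opprK.
have := neg _ _ (mixed _ _ b0 h); rewrite !opprK; apply.
Qed.

End SecantInequality.

(** * Frobenius inner product and pairs of eigenbases *)

Section FrobeniusInner.
Variables (R : realType) (m n : nat).
Implicit Types A B C D : 'M[R]_(m, n).

Lemma frob_innerE A B : frob_inner A B = \sum_i \sum_j A i j * B i j.
Proof.
rewrite /frob_inner /mxtrace exchange_big; apply: eq_bigr => j _.
by rewrite mxE; apply: eq_bigr => i _; rewrite mxE.
Qed.

Lemma frob_innerC A B : frob_inner A B = frob_inner B A.
Proof.
by rewrite !frob_innerE; apply: eq_bigr => i _; apply: eq_bigr => j _; rewrite mulrC.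
Qed.

Lemma frob_innerDr A B C : frob_inner A (B + C) = frob_inner A B + frob_inner A C.
Proof. by rewrite /frob_inner mulmxDr raddfD. Qed.

Lemma frob_innerZr c A B : frob_inner A (c *: B) = c * frob_inner A B.
Proof. by rewrite /frob_inner -scalemxAr linearZ. Qed.

Lemma frob_innerNr A B : frob_inner A (- B) = - frob_inner A B.
Proof. by rewrite -scaleN1r frob_innerZr mulN1r. Qed.

Lemma frob_innerBr A B C : frob_inner A (B - C) = frob_inner A B - frob_inner A C.
Proof. by rewrite frob_innerDr frob_innerNr. Qed.

Lemma frob_innerDl A B C : frob_inner (B + C) A = frob_inner B A + frob_inner C A.
Proof. by rewrite frob_innerC frob_innerDr !(frob_innerC A). Qed.

Lemma frob_innerZl c A B : frob_inner (c *: B) A = c * frob_inner B A.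
Proof. by rewrite frob_innerC frob_innerZr (frob_innerC A). Qed.

Lemma frob_innerBl A B C : frob_inner (B - C) A = frob_inner B A - frob_inner C A.
Proof. by rewrite frob_innerC frob_innerBr !(frob_innerC A). Qed.

Lemma frob_inner_swap A B C D :
  frob_inner (A - B) (C - D) = frob_inner (B - A) (D - C).
Proof. by rewrite !frob_innerBl !frob_innerBr; ring. Qed.

Lemma frob_inner0r A : frob_inner A 0 = 0.
Proof. by rewrite -(scale0r 0) frob_innerZr mul0r. Qed.

Lemma frob_inner0l A : frob_inner 0 A = 0.
Proof. by rewrite frob_innerC frob_inner0r. Qed.

Lemma frob_inner_ge0 A : 0 <= frob_inner A A.
Proof.
rewrite frob_innerE; apply: sumr_ge0 => i _; apply: sumr_ge0 => j _.
by rewrite -expr2 sqr_ge0.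
Qed.

Lemma frob_inner_eq0 A : frob_inner A A = 0 -> A = 0.
Proof.
rewrite frob_innerE => /eqP; rewrite psumr_eq0 => [/allP h|i _]; last first.
  by apply: sumr_ge0 => j _; rewrite -expr2 sqr_ge0.
apply/matrixP => i j; have := h i (mem_index_enum _).
rewrite psumr_eq0 => [/allP/(_ j (mem_index_enum _))|{}j _]; last first.
  by rewrite -expr2 sqr_ge0.
by rewrite -expr2 sqrf_eq0 mxE => /eqP.
Qed.

Lemma frob_inner_delta A i j : frob_inner A (delta_mx i j) = A i j.
Proof.
rewrite frob_innerE (bigD1 i) //= (bigD1 j) //= !mxE !eqxx mulr1.
rewrite !big1 ?addr0 // => [i' ne|j' ne]; last by rewrite mxE (negbTE ne) andbF mulr0.
by apply: big1 => j' _; rewrite mxE (negbTE ne) mulr0.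
Qed.

(** Used to turn a directional derivative into a gradient. *)
Lemma frob_inner_riesz (L : 'M[R]_(m, n) -> R) A : scalar L ->
  frob_inner (\matrix_(i, j) L (delta_mx i j)) A = L A.
Proof.
move=> Lscalar; pose Lin := GRing.isLinear.Build R 'M[R]_(m, n) R *%R L Lscalar.
pose L' : {scalar 'M[R]_(m, n)} := HB.pack L Lin.
change (frob_inner (\matrix_(i, j) L' (delta_mx i j)) A = L' A).
rewrite [in RHS](matrix_sum_delta A) linear_sum frob_innerE.
apply: eq_bigr => i _; rewrite linear_sum; apply: eq_bigr => j _.
by rewrite linearZ mxE mulrC.
Qed.

End FrobeniusInner.

Lemma frob_inner_cauchy (R : realType) m n (A B : 'M[R]_(m, n)) :
  frob_inner A B ^+ 2 <= frob_inner A A * frob_inner B B.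
Proof.
have [B0|B0] := eqVneq (frob_inner B B) 0.
  by rewrite (frob_inner_eq0 B0) !frob_inner0r expr0n mulr0.
have Bp : 0 < frob_inner B B by rewrite lt_def B0 frob_inner_ge0.
have := frob_inner_ge0 (A - (frob_inner A B / frob_inner B B) *: B).
rewrite !frob_innerBl !frob_innerBr !frob_innerZl !frob_innerZr (frob_innerC B A).
rewrite divfK // subrr subr0 subr_ge0 -(ler_pM2r Bp) mulrAC divfK //.
Qed.

Section EigenbasisCalculus.
Variables (R : realType) (n : nat).
Implicit Types (H M O P N A B : 'M[R]_n) (a b : 'rV[R]_n) (f g : R -> R).

(** The functional calculus g(H) for H with eigenbasis O and eigenvalues a. *)
Definition spfun g O a := O^T *m diag_mx (map_mx g a) *m O.

Lemma eigensystem_spfun H O a : eigensystem H O a -> H = spfun id O a.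
Proof. by case=> _ ->; rewrite /spfun map_mx_id. Qed.

Lemma rotate_spfun_l g O P a i j : O *m O^T = 1%:M ->
  (O *m spfun g O a *m P^T) i j = g (a 0 i) * (O *m P^T) i j.
Proof.
move=> OO; rewrite /spfun !mulmxA OO mul1mx -mulmxA.
by rewrite mul_diag_mx mxE [X in X * _]mxE.
Qed.

Lemma rotate_spfun_r g O P b i j : P *m P^T = 1%:M ->
  (O *m spfun g P b *m P^T) i j = g (b 0 j) * (O *m P^T) i j.
Proof.
move=> PP; rewrite /spfun !mulmxA -(mulmxA _ P) PP mulmx1.
by rewrite mul_mx_diag mxE [X in _ * X]mxE mulrC.
Qed.

(** Two different orthogonal matrices act on the two sides: the two matrices to
    be compared are diagonalized in different bases. *)
Lemma frob_inner_rotate O P A B : O^T *m O = 1%:M -> P^T *m P = 1%:M ->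
  frob_inner A B =
  \sum_i \sum_j (O *m A *m P^T) i j * (O *m B *m P^T) i j.
Proof.
move=> OO PP; rewrite -frob_innerE /frob_inner !trmx_mul trmxK !mulmxA.
rewrite -(mulmxA _ O^T) OO mulmx1 [in RHS]mxtrace_mulC !mulmxA PP mul1mx.
by [].
Qed.

Lemma sum_overlap_row O P i : O *m O^T = 1%:M -> P^T *m P = 1%:M ->
  \sum_j (O *m P^T) i j ^+ 2 = 1.
Proof.
move=> OO PP; have : ((O *m P^T) *m (O *m P^T)^T) i i = 1.
  by rewrite trmx_mul trmxK mulmxA -(mulmxA O) PP mulmx1 OO mxE eqxx.
by rewrite mxE => <-; apply: eq_bigr => j _; rewrite [X in _ = _ * X]mxE expr2.
Qed.

Lemma sum_overlap_col O P j : O^T *m O = 1%:M -> P *m P^T = 1%:M ->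
  \sum_i (O *m P^T) i j ^+ 2 = 1.
Proof.
move=> OO PP; rewrite -[RHS](sum_overlap_row j PP OO).
have -> : O *m P^T = (P *m O^T)^T by rewrite trmx_mul trmxK.
by apply: eq_bigr => i _; rewrite mxE.
Qed.

Variables (H M O P : 'M[R]_n) (a b : 'rV[R]_n).
Hypotheses (esH : eigensystem H O a) (esM : eigensystem M P b).

Let c i j := (O *m P^T) i j.

Lemma rotate_diff g g' i j :
  (O *m (spfun g' P b - spfun g O a) *m P^T) i j =
  (g' (b 0 j) - g (a 0 i)) * c i j.
Proof.
have [OO _] := esH; have [PP _] := esM.
rewrite mulmxBr mulmxBl mxE [X in _ + X]mxE rotate_spfun_r // rotate_spfun_l //.
by rewrite mulrBl.
Qed.

Lemma eigenbasis_pairing A :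
  frob_inner A (M - H) =
  \sum_i \sum_j (O *m A *m P^T) i j * ((b 0 j - a 0 i) * c i j).
Proof.
rewrite (frob_inner_rotate _ _ (eigensystem_orth esH) (eigensystem_orth esM)).
rewrite {1}(eigensystem_spfun esH) {1}(eigensystem_spfun esM).
apply: eq_bigr => i _; apply: eq_bigr => j _.
by rewrite rotate_diff.
Qed.

Lemma eigenbasis_monotone g :
  frob_inner (spfun g P b - spfun g O a) (M - H) =
  \sum_i \sum_j (g (b 0 j) - g (a 0 i)) * (b 0 j - a 0 i) * c i j ^+ 2.
Proof.
rewrite eigenbasis_pairing; apply: eq_bigr => i _; apply: eq_bigr => j _.
by rewrite rotate_diff expr2 /=; ring.
Qed.

Lemma eigenbasis_sum_l f : \sum_i f (a 0 i) = \sum_i \sum_j f (a 0 i) * c i j ^+ 2.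
Proof.
apply: eq_bigr => i _; rewrite -mulr_sumr sum_overlap_row ?mulr1 //.
  by case: esH.
exact: eigensystem_orth esM.
Qed.

Lemma eigenbasis_sum_r f : \sum_j f (b 0 j) = \sum_i \sum_j f (b 0 j) * c i j ^+ 2.
Proof.
rewrite exchange_big; apply: eq_bigr => j _.
rewrite -mulr_sumr sum_overlap_col ?mulr1 //.
  exact: eigensystem_orth esH.
by case: esM.
Qed.

(** Klein's device: for g the derivative of f, the divergence of the trace
    function M |-> tr f(M) is the scalar divergence of f averaged with the doubly
    stochastic weights c_ij^2, the squared overlaps of the two eigenbases. *)
Lemma eigenbasis_bregman f g :
  \sum_j f (b 0 j) - \sum_i f (a 0 i) - frob_inner (spfun g O a) (M - H) =
  \sum_i \sum_j (f (b 0 j) - f (a 0 i) - g (a 0 i) * (b 0 j - a 0 i)) * c i j ^+ 2.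
Proof.
have [OO _] := esH.
rewrite eigenbasis_sum_r eigenbasis_sum_l eigenbasis_pairing -!sumrB.
apply: eq_bigr => i _; rewrite -!sumrB; apply: eq_bigr => j _.
by rewrite rotate_spfun_l // -/(c i j); ring.
Qed.

Lemma frob_inner_diffE : frob_inner (M - H) (M - H) =
  \sum_i \sum_j (b 0 j - a 0 i) ^+ 2 * c i j ^+ 2.
Proof.
rewrite {1}(eigensystem_spfun esH) {1}(eigensystem_spfun esM) eigenbasis_monotone.
by apply: eq_bigr => i _; apply: eq_bigr => j _; rewrite -expr2.
Qed.

End EigenbasisCalculus.

(** * Bounds by the spectral norm and the rank *)

(** Selecting the nonzero diagonal entries factors an identity matrix through
    the diagonal matrix. *)
Lemma count_le_rank_diag (F : fieldType) n (e : 'rV[F]_n) :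
  (#|[pred i : 'I_n | e 0%R i != 0%R]| <= \rank (diag_mx e))%N.
Proof.
set I := [pred i : 'I_n | e 0 i != 0].
pose S : 'M[F]_(#|I|, n) := \matrix_(i, j) (enum_val i == j)%:R.
pose S' : 'M[F]_(n, #|I|) := \matrix_(i, j) ((e 0 i)^-1 * S j i).
suff E : S *m diag_mx e *m S' = 1%:M by exact: mulmx1_min_rank E.
apply/matrixP => i j; rewrite mul_mx_diag mxE (bigD1 (enum_val i)) //=.
rewrite big1 => [|l li]; last first.
  by rewrite !mxE eq_sym (negbTE li) !mul0r.
have := enum_valP i; rewrite inE => ei; rewrite !mxE eqxx mul1r addr0.
by rewrite mulrA divff // mul1r eq_sym (inj_eq enum_val_inj).
Qed.

(** The pointwise hypothesis says that s^2 u_i - 2 s y_i + v_i >= 0 for all s;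
    sum over i and take the discriminant. *)
Lemma sum_cauchy (R : realType) (I : finType) (y u v : I -> R) :
  (forall i, 0 <= u i) -> (forall i, 0 <= v i) ->
  (forall i, y i ^+ 2 <= u i * v i) ->
  (\sum_i y i) ^+ 2 <= (\sum_i u i) * \sum_i v i.
Proof.
move=> u0 v0 yuv; set Y := \sum_i y i; set U := \sum_i u i; set V := \sum_i v i.
have pt s i : 0 <= s ^+ 2 * u i - 2 * s * y i + v i.
  have [ui|ui] := eqVneq (u i) 0.
    have /eqP : y i ^+ 2 = 0.
      by apply/le_anti; rewrite sqr_ge0 andbT (le_trans (yuv i)) // ui mul0r.
    by rewrite sqrf_eq0 ui => /eqP ->; rewrite !mulr0 subr0 add0r.
  have up : 0 < u i by rewrite lt_def ui u0.
  rewrite -(pmulr_rge0 _ up).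
  have -> : u i * (s ^+ 2 * u i - 2 * s * y i + v i) =
    (s * u i - y i) ^+ 2 + (u i * v i - y i ^+ 2) by ring.
  by rewrite addr_ge0 ?sqr_ge0 // subr_ge0.
have quad s : 0 <= s ^+ 2 * U - 2 * s * Y + V.
  rewrite /U /Y /V !mulr_sumr -sumrB -big_split /=.
  by apply: sumr_ge0 => i _; exact: pt.
have [U0|U0] := eqVneq U 0.
  have V0 : 0 <= V by apply: sumr_ge0.
  have := quad ((V + 1) / (2 * Y)).
  have [->|Y0] := eqVneq Y 0; first by rewrite U0 mul0r expr0n.
  rewrite U0 mulr0 sub0r.
  have -> : 2 * ((V + 1) / (2 * Y)) * Y = V + 1 by field.
  lra.
have Up : 0 < U by rewrite lt_def U0 sumr_ge0.
have := quad (Y / U).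
have -> : (Y / U) ^+ 2 * U - 2 * (Y / U) * Y + V = (U * V - Y ^+ 2) / U by field.
by rewrite pmulr_lge0 ?invr_gt0 // subr_ge0.
Qed.

Section DilationBounds.
Variables (R : realType) (m k : nat).
Implicit Types (Q W V : 'M[R]_(m, k)) (O P N : 'M[R]_(m + k)).

Lemma singular_values_le_spectral_norm W j :
  singular_values W 0 j <= spectral_norm W.
Proof. exact: le_bigmax. Qed.

Lemma spectral_norm_ge0 W : 0 <= spectral_norm W.
Proof. exact: bigmax_ge_id. Qed.

(** Apply [sum_dilation] to the indicator of the reals above the squared
    spectral norm. *)
Lemma dilation_eigenvalue_le W N e i : eigensystem (dilation W) N e ->
  e 0 i ^+ 2 <= spectral_norm W ^+ 2.
Proof.
move=> es; set w := spectral_norm W.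
pose h (x : R) : R := ((w ^+ 2 < x)%R)%:R.
have h0 : h 0 = 0 by rewrite /h ltNge sqr_ge0.
have := sum_dilation es h0; rewrite [X in _ = 2 * X]big1 => [|j _].
  rewrite mulr0 => /eqP; rewrite psumr_eq0 => [/allP/(_ i (mem_index_enum _))|j _].
    by rewrite /= /h; case: ltP => //; rewrite oner_eq0.
  by rewrite /h ler0n.
rewrite /h ltNge ler_sqr ?nnegrE ?singular_values_ge0 ?spectral_norm_ge0 //.
by rewrite singular_values_le_spectral_norm.
Qed.

(** The rows of a rotated dilation of W are images of unit vectors, so their
    norm is at most the operator norm; this replaces the trace norm duality. *)
Lemma sum_rotate_row W O P i : O *m O^T = 1%:M -> P^T *m P = 1%:M ->
  \sum_j (O *m dilation W *m P^T) i j ^+ 2 <= spectral_norm W ^+ 2.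
Proof.
move=> OO PP; have [N [e es]] := dilation_eigensystem W.
have [NN _] := es; have NtN := eigensystem_orth es.
have rowE P' : P'^T *m P' = 1%:M -> \sum_j (O *m dilation W *m P'^T) i j ^+ 2 =
    (O *m dilation W *m (O *m dilation W)^T) i i.
  move=> PP'; move: (O *m dilation W) => D.
  have -> : D *m D^T = (D *m P'^T) *m (D *m P'^T)^T.
    by rewrite trmx_mul trmxK mulmxA -(mulmxA D) PP' mulmx1.
  by rewrite [RHS]mxE; apply: eq_bigr => j _; rewrite [X in _ = _ * X]mxE expr2.
rewrite rowE // -(rowE N NtN) -[leRHS]mulr1 -(sum_overlap_row i OO NtN) mulr_sumr.
apply: ler_sum => l _.
rewrite {1}(eigensystem_spfun es) rotate_spfun_r // exprMn.
by rewrite ler_wpM2r ?sqr_ge0 // (dilation_eigenvalue_le _ es).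
Qed.

Lemma sum_rotate_col W O P j : O^T *m O = 1%:M -> P *m P^T = 1%:M ->
  \sum_i (O *m dilation W *m P^T) i j ^+ 2 <= spectral_norm W ^+ 2.
Proof.
move=> OO PP; apply: le_trans (sum_rotate_row W j PP OO).
have -> : O *m dilation W *m P^T = (P *m dilation W *m O^T)^T.
  by rewrite !trmx_mul trmxK dilation_sym mulmxA.
by apply: ler_sum => i _; rewrite mxE.
Qed.

Lemma frob_inner_dilation (G : 'M[R]_(m + k)) V :
  frob_inner G (dilation V) = frob_inner (ursubmx G + (dlsubmx G)^T) V.
Proof.
rewrite frob_innerDl /frob_inner -[G in LHS]submxK tr_block_mx mulmx_block.
rewrite mxtrace_block !mulmx0 add0r addr0 trmxK addrC.
congr (_ + _).
by rewrite -trmx_mul mxtrace_tr mxtrace_mulC.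
Qed.

Lemma frob_inner_dilation2 Q V :
  frob_inner (dilation Q) (dilation V) = 2 * frob_inner Q V.
Proof.
by rewrite frob_inner_dilation block_mxKur block_mxKdl trmxK frob_innerDl; ring.
Qed.

Lemma frob_inner_singular_values Q :
  frob_inner Q Q = \sum_j singular_values Q 0 j ^+ 2.
Proof.
have [N [e es]] := dilation_eigensystem Q.
have [NN _] := es; have NtN := eigensystem_orth es.
apply: (@mulfI _ 2); first by rewrite pnatr_eq0.
rewrite -frob_inner_dilation2 -(sum_dilation (h := id) es erefl).
rewrite (frob_inner_rotate _ _ NtN NtN) exchange_big; apply: eq_bigr => j _.
under eq_bigr do rewrite {1 2}(eigensystem_spfun es) rotate_spfun_r // -expr2 exprMn.
by rewrite -mulr_sumr sum_overlap_col // mulr1.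
Qed.

Lemma count_singular_values Q :
  (#|[pred j : 'I_k | singular_values Q 0%R j != 0%R]| <= \rank Q)%N.
Proof.
have [N [e es]] := dilation_eigensystem Q.
have [NN NE] := es; have NtN := eigensystem_orth es.
have := sum_dilation (h := fun x : R => ((x != 0)%R)%:R) es.
rewrite eqxx => /(_ erefl); rewrite -!natr_sum -natrM => /eqP.
rewrite eqr_nat.
under eq_bigr do rewrite sqrf_eq0.
under [X in _ == (_ * X)%N]eq_bigr do rewrite sqrf_eq0.
move=> /eqP cnt.
rewrite -(leq_pmul2l (ltn0Sn 1)).
have rk : (\rank (diag_mx e) <= 2 * \rank Q)%N.
  have -> : diag_mx e = N *m dilation Q *m N^T.
    by rewrite NE !mulmxA NN mul1mx -mulmxA NN mulmx1.
  apply: leq_trans (mxrankM_maxl _ _) _; apply: leq_trans (mxrankM_maxr _ _) _.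
  have -> : dilation Q = block_mx Q 0 0 Q^T *m block_mx 0 1%:M 1%:M 0.
    by rewrite mulmx_block !(mulmx0, mul0mx, mulmx1, addr0, add0r).
  apply: leq_trans (mxrankM_maxl _ _) _.
  by rewrite rank_diag_block_mx mxrank_tr mul2n addnn.
apply: leq_trans rk; apply: leq_trans (count_le_rank_diag e).
have cardE (I : finType) (P : pred I) : #|[pred i | P i]| = (\sum_i P i)%N.
  by rewrite -sum1_card big_mkcond; apply: eq_bigr => i _; rewrite inE; case: (P i).
by rewrite !cardE cnt.
Qed.

Lemma sum_singular_values_le Q (f : R -> R) : f 0 = 0 ->
  {in Num.nneg &, {homo f : x y / x <= y}} ->
  \sum_j f (singular_values Q 0 j) <= (\rank Q)%:R * f (spectral_norm Q).
Proof.
move=> f0 fmono.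
have fs : 0 <= f (spectral_norm Q).
  by rewrite -f0 fmono ?nnegrE ?spectral_norm_ge0.
pose N := #|[pred j : 'I_k | singular_values Q 0 j != 0]|.
apply: (@le_trans _ _ (N%:R * f (spectral_norm Q))); last first.
  by rewrite ler_wpM2r // ler_nat count_singular_values.
rewrite /N -sum1_card natr_sum mulr_suml [leRHS]big_mkcond /=.
apply: ler_sum => j _; rewrite inE; case: eqVneq => [->|_] /=; first by rewrite f0.
by rewrite mul1r fmono ?nnegrE ?singular_values_ge0 ?spectral_norm_ge0 //
  singular_values_le_spectral_norm.
Qed.

Lemma rank_le_minn Q : (\rank Q <= minn m k)%N.
Proof. by rewrite leq_min rank_leq_row rank_leq_col. Qed.

(** Only min(m, k) singular values can be nonzero; the factor is responsible for
    the power of the dimension in the mirror map. *)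
Lemma frob_inner_le_spectral_norm W :
  frob_inner W W <= (minn m k)%:R * spectral_norm W ^+ 2.
Proof.
rewrite frob_inner_singular_values.
apply: le_trans (sum_singular_values_le (f := fun x => x ^+ 2) W _ _) _.
- by rewrite expr0n.
- by move=> x y x0 y0 xy; rewrite ler_sqr.
by rewrite ler_wpM2r ?sqr_ge0 // ler_nat rank_le_minn.
Qed.

Lemma sum_rotate W O P : O^T *m O = 1%:M -> P^T *m P = 1%:M ->
  \sum_i \sum_j (O *m dilation W *m P^T) i j ^+ 2 <=
  2 * ((minn m k)%:R * spectral_norm W ^+ 2).
Proof.
move=> OO PP; apply: le_trans (_ : 2 * frob_inner W W <= _).
  rewrite -frob_inner_dilation2 (frob_inner_rotate _ _ OO PP).
  by apply: ler_sum => i _; apply: ler_sum => j _; rewrite expr2.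
by rewrite ler_pM2l // frob_inner_le_spectral_norm.
Qed.

End DilationBounds.

(** * Power sums of singular values *)

Section SchattenPower.
Variables (R : realType) (m k : nat).
Implicit Types (Q W V H M : 'M[R]_(m, k)) (p q r : R).

Definition dilation_basis Q : 'M[R]_(m + k) :=
  projT1 (cid (dilation_eigensystem Q)).

Definition dilation_eigenvalues Q : 'rV[R]_(m + k) :=
  projT1 (cid (projT2 (cid (dilation_eigensystem Q)))).

Lemma dilation_basisP Q :
  eigensystem (dilation Q) (dilation_basis Q) (dilation_eigenvalues Q).
Proof. exact: projT2 (cid (projT2 (cid (dilation_eigensystem Q)))). Qed.

(** The sum and its gradient below are sealed behind their defining equations:
    otherwise unification would compare the values at two different matrices by
    unfolding them down to the spectral data. *)
Lemma schatten_sum_key :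
  {f : R -> 'M[R]_(m, k) -> R |
    forall p Q, f p Q = \sum_j singular_values Q 0 j `^ p}.
Proof. by exists (fun p Q => \sum_j singular_values Q 0 j `^ p). Qed.

Definition schatten_sum := sval schatten_sum_key.

Lemma schatten_sumE p Q : schatten_sum p Q = \sum_j singular_values Q 0 j `^ p.
Proof. exact: (svalP schatten_sum_key). Qed.

Lemma schatten_sum_ge0 p Q : 0 <= schatten_sum p Q.
Proof. by rewrite schatten_sumE; apply: sumr_ge0 => j _; rewrite powR_ge0. Qed.

Lemma powR_sqr_half p (x : R) : (x ^+ 2) `^ (p / 2) = `|x| `^ p.
Proof.
rewrite -real_normK ?num_real // -powR_mulrn // -powRrM.
by congr (_ `^ _); field.
Qed.

Lemma schatten_sum_dilation p Q O a : p != 0 -> eigensystem (dilation Q) O a ->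
  schatten_sum p Q = 2^-1 * \sum_i `|a 0 i| `^ p.
Proof.
move=> p0 es; have h0 : (fun x : R => x `^ (p / 2)) 0 = 0.
  by rewrite powR0 // mulf_neq0 // invr_neq0.
have := sum_dilation (h := fun x : R => x `^ (p / 2)) es h0.
under eq_bigr do rewrite powR_sqr_half.
under [in RHS]eq_bigr do rewrite powR_sqr_half ger0_norm ?singular_values_ge0 //.
by rewrite -schatten_sumE => ->; rewrite mulKf.
Qed.

Lemma schatten_sum_eq0 p Q : p != 0 -> schatten_sum p Q = 0 -> Q = 0.
Proof.
move=> p0 /eqP; rewrite schatten_sumE psumr_eq0 => [/allP s0|j _]; last exact: powR_ge0.
apply: frob_inner_eq0; rewrite frob_inner_singular_values big1 // => j _.
have := s0 j (mem_index_enum _); rewrite /= powR_eq0 p0 andbT => /eqP ->.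
by rewrite expr0n.
Qed.

Lemma schatten_grad_key :
  {g : R -> 'M[R]_(m, k) -> 'M[R]_(m, k) | forall p Q V,
    frob_inner (g p Q) V = p / 2 * frob_inner
      (spfun (sgpow (p - 1)) (dilation_basis Q) (dilation_eigenvalues Q))
      (dilation V)}.
Proof.
pose G p Q := spfun (sgpow (p - 1)) (dilation_basis Q) (dilation_eigenvalues Q).
exists (fun p Q => (p / 2) *: (ursubmx (G p Q) + (dlsubmx (G p Q))^T)) => p Q V.
by rewrite frob_inner_dilation frob_innerZl.
Qed.

Definition schatten_grad := sval schatten_grad_key.

Lemma schatten_gradE p Q V : frob_inner (schatten_grad p Q) V =
  p / 2 * frob_inner
    (spfun (sgpow (p - 1)) (dilation_basis Q) (dilation_eigenvalues Q))
    (dilation V).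
Proof. exact: (svalP schatten_grad_key). Qed.

(** Klein's inequality for |x|^p, applied to the dilations. *)
Lemma schatten_sum_convex p H M : 1 < p ->
  schatten_sum p H + frob_inner (schatten_grad p H) (M - H) <= schatten_sum p M.
Proof.
move=> p1; have p0 : p != 0 by rewrite gt_eqF //; lra.
have halves (x y z b : R) : z - y - p * x = b -> 0 <= b ->
    2^-1 * y + p / 2 * x <= 2^-1 * z by lra.
have esH := dilation_basisP H; have esM := dilation_basisP M.
rewrite schatten_gradE (schatten_sum_dilation p0 esH) (schatten_sum_dilation p0 esM).
rewrite linearB /=.
have := eigenbasis_bregman esH esM (fun x => `|x| `^ p) (fun x => p * sgpow (p - 1) x).
have -> : spfun (fun x => p * sgpow (p - 1) x) (dilation_basis H) (dilation_eigenvalues H)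
   = p *: spfun (sgpow (p - 1)) (dilation_basis H) (dilation_eigenvalues H).
  rewrite /spfun scalemxAl scalemxAr; congr (_ *m _ *m _).
  by apply/matrixP => i j; rewrite !mxE mulrnAr.
rewrite frob_innerZl.
set B := \sum_i \sum_j _ => BE; have B0 : 0 <= B.
  apply: sumr_ge0 => i _; apply: sumr_ge0 => j _; rewrite mulr_ge0 ?sqr_ge0 //.
  by rewrite -mulrA powR_bregman_ge0.
exact: halves BE B0.
Qed.

Lemma schatten_grad_monotoneE p H M :
  frob_inner (schatten_grad p M - schatten_grad p H) (M - H) =
  p / 2 * \sum_i \sum_j
   (sgpow (p - 1) (dilation_eigenvalues M 0 j) -
    sgpow (p - 1) (dilation_eigenvalues H 0 i)) *
   (dilation_eigenvalues M 0 j - dilation_eigenvalues H 0 i) *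
   (dilation_basis H *m (dilation_basis M)^T) i j ^+ 2.
Proof.
rewrite frob_innerBl !schatten_gradE -mulrBr -frob_innerBl linearB /=.
by rewrite (eigenbasis_monotone (dilation_basisP H) (dilation_basisP M)).
Qed.

(** Distinguish whether x is below t; t is a free scale that is later taken to
    be the step length, where both terms have the same order. *)
Lemma powR_young_sqr p (t x : R) : 1 < p < 2 -> 0 < t -> 0 <= x ->
  x `^ p <= t `^ (p - 2) * x ^+ 2 + t `^ p.
Proof.
move=> /andP[p1 p2] t0 x0; have [xt|tx] := leP x t.
  apply: (@le_trans _ _ (t `^ p)).
    by rewrite ge0_ler_powR ?nnegrE ?(ltW t0) //; lra.
  by rewrite lerDr mulr_ge0 ?powR_ge0 ?sqr_ge0.
have {}x0 : 0 < x by exact: lt_trans tx.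
have -> : x `^ p = x `^ (p - 2) * x ^+ 2.
  rewrite -powR_mulrn ?(ltW x0) // -powRD ?subrK //.
  by rewrite (gt_eqF x0) implybT.
rewrite ler_wpDr ?powR_ge0 // ler_wpM2r ?sqr_ge0 //.
rewrite -(opprB 2 p) !powRN lef_pV2 ?posrE ?powR_gt0 //.
by rewrite ge0_ler_powR ?nnegrE ?(ltW t0) ?(ltW x0) ?(ltW tx) //; lra.
Qed.

(** Hoelder continuity of [sgpow (p - 1)] averaged over the overlaps.  For
    M = H + h V and t = |h| the right-hand side is of order |h|^p with p > 1,
    which makes the gradient continuous along lines. *)
Lemma schatten_grad_holder p (t : R) H M : 1 < p < 2 -> 0 < t ->
  frob_inner (schatten_grad p M - schatten_grad p H) (M - H) <=
  p * (t `^ (p - 2) * (2 * frob_inner (M - H) (M - H)) + t `^ p * (m + k)%:R).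
Proof.
move=> p12 t0; have /andP[p1 p2] := p12.
have esH := dilation_basisP H; have esM := dilation_basisP M.
rewrite schatten_grad_monotoneE -frob_inner_dilation2 linearB /=.
rewrite (frob_inner_diffE esH esM).
have Hone := eigenbasis_sum_l esH esM (fun=> 1).
rewrite sumr_const card_ord -mulr_natr mul1r in Hone.
rewrite Hone !mulr_sumr -big_split /= mulr_sumr.
apply: ler_sum => i _; rewrite !mulr_sumr -big_split /= mulr_sumr.
apply: ler_sum => j _.
set a := dilation_eigenvalues H 0 i; set b := dilation_eigenvalues M 0 j.
set c := (_ *m _) i j.
have hold : (sgpow (p - 1) b - sgpow (p - 1) a) * (b - a) <= 2 * `|b - a| `^ p.
  apply: le_trans (ler_norm _) _; rewrite normrM.
  have p01 : 0 < p - 1 <= 1 by apply/andP; split; lra.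
  have p0 : 0 < p by lra.
  have := ler_wpM2r (normr_ge0 (b - a)) (sgpow_holder a b p01).
  by rewrite -(mulrA 2) (mulrC (_ `^ _)) mulr_powRB1.
have := powR_young_sqr p12 t0 (normr_ge0 (b - a)).
rewrite real_normK ?num_real // mul1r => young.
have {young hold} : (sgpow (p - 1) b - sgpow (p - 1) a) * (b - a) <=
   2 * (t `^ (p - 2) * (b - a) ^+ 2 + t `^ p) by lra.
move=> /(ler_wpM2r (sqr_ge0 c)).
have p20 : 0 <= p / 2 by lra.
move=> /(ler_wpM2l p20); lra.
Qed.

(** In the two eigenbases <W, M - H> is half the sum of
    x_ij (b_j - a_i) c_ij, where x is the rotated dilation of W.  Split each
    term by the secant slope of [sgpow (p - 1)] and use Cauchy-Schwarz: one
    factor is the pairing of the gradients, the other one is the sum of x_ij^2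
    over the slopes.  The latter is estimated by [sgpow_secant], which is affine
    in |a_i|^p and |b_j|^p, and by the bounds on rows, columns and total of
    x_ij^2. *)
Lemma schatten_grad_strong p q r W H M :
  1 < p -> 2 < q -> p^-1 + q^-1 = 1 -> r = 1 - 2 / q ->
  frob_inner W (M - H) ^+ 2 <=
  spectral_norm W ^+ 2 * ((minn m k)%:R `^ (1 - r) / (p * (p - 1)) *
    Num.max (schatten_sum p H) (schatten_sum p M) `^ r) *
  frob_inner (schatten_grad p M - schatten_grad p H) (M - H).
Proof.
move=> p1 q2 pq rE; have p0 : p != 0 by rewrite gt_eqF //; lra.
have r01 := dual_exponent_bounds q2 rE; have /andP[r0 r1] := r01.
set Phi := Num.max _ _; set D := (minn m k)%:R; set w := spectral_norm W.
have HPhi : schatten_sum p H <= Phi by rewrite le_max lexx.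
have MPhi : schatten_sum p M <= Phi by rewrite le_max lexx orbT.
have Phi_ge0 : 0 <= Phi by apply: le_trans HPhi; exact: schatten_sum_ge0.
have [Phi0|PhiN0] := eqVneq Phi 0.
  have zero Q : schatten_sum p Q <= Phi -> Q = 0.
    move=> QP; apply: (schatten_sum_eq0 p0); apply/le_anti.
    by rewrite schatten_sum_ge0 andbT -Phi0.
  by rewrite (zero _ HPhi) (zero _ MPhi) subrr !frob_inner0r expr0n mulr0.
have PhiP : 0 < Phi by rewrite lt_def PhiN0.
(* If m or k is 0 all matrices are equal. *)
have [D0|DN0] := eqVneq D 0.
  have := frob_inner_le_spectral_norm (M - H).
  rewrite -/D D0 mul0r => MH0.
  have /frob_inner_eq0 -> : frob_inner (M - H) (M - H) = 0.
    by apply/le_anti; rewrite MH0 frob_inner_ge0.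
  by rewrite !frob_inner0r expr0n mulr0.
have DP : 0 < D by rewrite lt_def DN0 ler0n.
(* This L makes the two terms of the tangent bound sum to D L^r. *)
pose L := Phi / D; have L0 : 0 < L by rewrite divr_gt0.
have esH := dilation_basisP H; have esM := dilation_basisP M.
have [OO _] := esH; have [PP _] := esM.
have OtO := eigensystem_orth esH; have PtP := eigensystem_orth esM.
rewrite schatten_grad_monotoneE.
set S := \sum_i \sum_j _.
pose O := dilation_basis H; pose P := dilation_basis M.
pose a i := dilation_eigenvalues H 0 i; pose b j := dilation_eigenvalues M 0 j.
pose c i j := (O *m P^T) i j; pose x i j := (O *m dilation W *m P^T) i j.
pose u i j := x i j ^+ 2 * ((1 - r) * L `^ r +
  r * L `^ (r - 1) * ((`|a i| `^ p + `|b j| `^ p) / 2)).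
pose v i j := (p - 1)^-1 * ((sgpow (p - 1) (b j) - sgpow (p - 1) (a i)) *
  (b j - a i) * c i j ^+ 2).
have w0 : 0 <= w ^+ 2 by rewrite sqr_ge0.
have K0 i j : 0 < (1 - r) * L `^ r +
    r * L `^ (r - 1) * ((`|a i| `^ p + `|b j| `^ p) / 2).
  rewrite ltr_wpDr ?mulr_gt0 ?powR_gt0 ?subr_gt0 //.
  by rewrite !mulr_ge0 ?addr_ge0 ?powR_ge0 ?(ltW r0).
have p10 : 0 < (p - 1)^-1 by rewrite invr_gt0 subr_gt0.
have secant i j := sgpow_secant (a i) (b j) p1 q2 pq rE L0.
have mono i j : 0 <= (sgpow (p - 1) (b j) - sgpow (p - 1) (a i)) * (b j - a i).
  rewrite -(pmulr_lge0 _ (K0 i j)); apply: le_trans (secant i j).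
  by rewrite mulr_ge0 ?sqr_ge0 //; lra.
have cs : (\sum_i \sum_j x i j * ((b j - a i) * c i j)) ^+ 2 <=
    (\sum_i \sum_j u i j) * (\sum_i \sum_j v i j).
  rewrite !pair_bigA /=; apply: sum_cauchy => -[i j] /=.
  - by rewrite /u mulr_ge0 ?sqr_ge0 // ltW.
  - by rewrite /v mulr_ge0 ?(ltW p10) // mulr_ge0 ?sqr_ge0 // mono.
  rewrite /u /v.
  have := ler_wpM2l (mulr_ge0 (mulr_ge0 (ltW p10) (sqr_ge0 (x i j))) (sqr_ge0 (c i j)))
    (secant i j).
  have -> : (p - 1)^-1 * x i j ^+ 2 * c i j ^+ 2 * ((p - 1) * (b j - a i) ^+ 2) =
    (x i j * ((b j - a i) * c i j)) ^+ 2 by field; lra.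
  by move/le_trans; apply; rewrite le_eqVlt; apply/orP; left; apply/eqP; ring.
have uE : \sum_i \sum_j u i j <= 2 * (w ^+ 2 * (D * L `^ r)).
  have -> : \sum_i \sum_j u i j = (1 - r) * L `^ r * \sum_i \sum_j x i j ^+ 2 +
     r * L `^ (r - 1) / 2 * (\sum_i \sum_j `|a i| `^ p * x i j ^+ 2 +
       \sum_i \sum_j `|b j| `^ p * x i j ^+ 2).
    rewrite -big_split /= !mulr_sumr -big_split; apply: eq_bigr => i _ /=.
    rewrite -big_split /= !mulr_sumr -big_split; apply: eq_bigr => j _ /=.
    by rewrite /u; ring.
  have sx : \sum_i \sum_j x i j ^+ 2 <= 2 * (D * w ^+ 2).
    exact: sum_rotate.
  have sa : \sum_i \sum_j `|a i| `^ p * x i j ^+ 2 <= 2 * Phi * w ^+ 2.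
    apply: (@le_trans _ _ (2 * schatten_sum p H * w ^+ 2)); last first.
      by rewrite ler_wpM2r // ler_pM2l.
    rewrite (schatten_sum_dilation p0 esH) mulVKf // mulr_suml.
    apply: ler_sum => i _; rewrite -mulr_sumr ler_wpM2l ?powR_ge0 //.
    exact: sum_rotate_row.
  have sb : \sum_i \sum_j `|b j| `^ p * x i j ^+ 2 <= 2 * Phi * w ^+ 2.
    apply: (@le_trans _ _ (2 * schatten_sum p M * w ^+ 2)); last first.
      by rewrite ler_wpM2r // ler_pM2l.
    rewrite (schatten_sum_dilation p0 esM) mulVKf // mulr_suml.
    rewrite exchange_big.
    apply: ler_sum => j _; rewrite -mulr_sumr ler_wpM2l ?powR_ge0 //.
    exact: sum_rotate_col.
  have Lr : L `^ (r - 1) * Phi = D * L `^ r.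
    have -> : Phi = L * D by rewrite divfK.
    by rewrite mulrA (mulrC _ L) mulr_powRB1 ?(ltW L0) // mulrC.
  have t1 : 0 <= (1 - r) * L `^ r by rewrite mulr_ge0 ?powR_ge0 //; lra.
  have t2 : 0 <= r * L `^ (r - 1) / 2.
    by rewrite !mulr_ge0 ?powR_ge0 ?(ltW r0).
  have h1 := ler_wpM2l t1 sx; have h2 := ler_wpM2l t2 (lerD sa sb).
  apply: le_trans (lerD h1 h2) _; rewrite le_eqVlt; apply/orP; left; apply/eqP.
  have -> : r * L `^ (r - 1) / 2 * (2 * Phi * w ^+ 2 + 2 * Phi * w ^+ 2) =
     2 * r * w ^+ 2 * (L `^ (r - 1) * Phi) by field.
  by rewrite Lr; ring.
have vE : \sum_i \sum_j v i j = (p - 1)^-1 * S.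
  by rewrite /v /S mulr_sumr; apply: eq_bigr => i _; rewrite mulr_sumr.
have S0 : 0 <= S.
  by apply: sumr_ge0 => i _; apply: sumr_ge0 => j _; rewrite mulr_ge0 ?sqr_ge0.
have DL : D * L `^ r = D `^ (1 - r) * Phi `^ r.
  rewrite /L powRM ?(ltW PhiP) ?invr_ge0 ?(ltW DP) //.
  rewrite -powR_inv1 ?(ltW DP) // -powRrM mulN1r mulrCA mulrC; congr (_ * _).
  rewrite -[X in X * _](powRr1 (ltW DP)) -powRD //.
  by rewrite (gt_eqF DP) implybT.
have pairE : \sum_i \sum_j x i j * ((b j - a i) * c i j) = 2 * frob_inner W (M - H).
  rewrite -frob_inner_dilation2 linearB /=.
  by rewrite (eigenbasis_pairing esH esM).
move: cs; rewrite pairE vE => cs.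
have -> : D `^ (1 - r) / (p * (p - 1)) * Phi `^ r = D * L `^ r / (p * (p - 1)).
  by rewrite DL mulrAC.
have := le_trans cs (ler_wpM2r (mulr_ge0 (ltW p10) S0) uE).
have -> : w ^+ 2 * (D * L `^ r / (p * (p - 1))) * (p / 2 * S) = 
  4^-1 * (2 * (w ^+ 2 * (D * L `^ r)) * ((p - 1)^-1 * S)).
  by field; apply/andP; split; lra.
rewrite exprMn; lra.
Qed.

End SchattenPower.

(** * Gradients and monotonicity of convex functions *)

Section ConvexGradient.
Variables (R : realType) (m n : nat).
Variables (F : 'M[R]_(m, n) -> R) (G : 'M[R]_(m, n) -> 'M[R]_(m, n)).
Implicit Types (H M V : 'M[R]_(m, n)).

(** The difference quotient at h lies between <G H, V> and <G (H + h V), V>. *)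
Lemma convex_derive H V :
  (forall H M, F H + frob_inner (G H) (M - H) <= F M) ->
  {for 0, continuous (fun h : R => frob_inner (G (H + h *: V)) V)} ->
  'D_V F H = frob_inner (G H) V.
Proof.
move=> convF contG; rewrite /derive; apply/cvg_lim => //.
apply/cvgrPdist_le => e e0.
move/cvgrPdist_le : contG => /(_ e e0); rewrite scale0r addr0 => near0.
near=> h.
have hn0 : h != 0 by near: h; exact: nbhs_dnbhs_neq.
have : `|frob_inner (G H) V - frob_inner (G (H + h *: V)) V| <= e.
  by near: h; apply: cvg_within near0.
set gh := frob_inner (G (H + h *: V)) V; set g := frob_inner (G H) V => ge.
have lo : h * g <= F (h *: V + H) - F H.
  have := convF H (h *: V + H); rewrite addrK frob_innerZr -/g; lra.
have hi : F (h *: V + H) - F H <= h * gh.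
  have := convF (h *: V + H) H.
  rewrite opprD addrCA subrr addr0 frob_innerNr frob_innerZr [_ *: _ + _]addrC -/gh.
  lra.
rewrite /= /GRing.scale /=; set D := F (h *: V + H) - F H in lo hi *.
apply: le_trans ge; rewrite distrC [leRHS]distrC.
have gE : h^-1 * D - g = h^-1 * (D - h * g) by field.
have ghE : gh - g = h^-1 * (h * gh - h * g) by field.
rewrite gE ghE !normrM ler_wpM2l // !ger0_norm ?subr_ge0 //; first lra.
by apply: le_trans hi.
Unshelve. all: by end_near. Qed.

Lemma convex_gradient H :
  (forall H M, F H + frob_inner (G H) (M - H) <= F M) ->
  (forall V, {for 0, continuous (fun h : R => frob_inner (G (H + h *: V)) V)}) ->
  gradient F H = G H.
Proof.
move=> convF contG; apply/matrixP => i j; rewrite mxE.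
by rewrite (convex_derive convF (contG _)) frob_inner_delta.
Qed.

Lemma convex_subgradient_unique H Z :
  (forall H M, F H + frob_inner (G H) (M - H) <= F M) ->
  (forall V, {for 0, continuous (fun h : R => frob_inner (G (H + h *: V)) V)}) ->
  (forall M, F H + frob_inner Z (M - H) <= F M) ->
  Z = G H.
Proof.
move=> convF contG subZ; pose V := Z - G H; pose g h := frob_inner (G (H + h *: V)) V.
suff V0 : frob_inner V V <= 0.
  apply/eqP; rewrite -subr_eq0; apply/eqP; apply: frob_inner_eq0; apply/le_anti.
  by rewrite V0 frob_inner_ge0.
rewrite {1}/V frob_innerBl subr_le0; apply/ler_addgt0Pr => e e0.
have := contG V; move/cvgrPdist_le => /(_ e e0); rewrite scale0r addr0.
move=> /nbhs_ballP[d /= d0 hd]; have d20 : 0 < d / 2 by rewrite divr_gt0.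
have := hd (d / 2); rewrite /ball /= sub0r normrN gtr0_norm // => /(_ _)/wrap[].
  by rewrite gtr_pMr // invf_lt1 // ltr1n.
rewrite ler_distl => /andP[hle _].
have XH : H + (d / 2) *: V - H = (d / 2) *: V by rewrite addrC addKr.
have h1 := subZ (H + (d / 2) *: V); rewrite XH frob_innerZr in h1.
have h2 := convF (H + (d / 2) *: V) H.
rewrite -opprB XH frob_innerNr frob_innerZr in h2.
have : d / 2 * frob_inner Z V <= d / 2 * frob_inner (G (H + d / 2 *: V)) V by lra.
rewrite ler_pM2l // => /le_trans; apply; move: hle; lra.
Qed.

End ConvexGradient.

Section LocalToGlobal.
Variable R : realType.

(** Take the supremum of the t such that u >= u a on [a, t]. *)
Lemma locally_increasing (u : R -> R) (a b : R) :
  (forall t, \forall s \near t, 0 <= (u s - u t) * (s - t)) ->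
  a <= b -> u a <= u b.
Proof.
move=> loc ab.
pose S := [set t : R | a <= t <= b /\ forall s, a <= s <= t -> u a <= u s]%classic.
have Sa : S a.
  split; first by rewrite lexx.
  by move=> s sa; have -> : s = a by apply/le_anti; rewrite andbC.
have supS : has_sup S by split; [exists a|exists b => t [/andP[]]].
set c := sup S.
have ac : a <= c by apply: sup_upper_bound.
have cb : c <= b by apply: sup_le_ub; [exists a|move=> t [/andP[]]].
have [d /= d0 hd] := (nbhs_ballP _ _).1 (loc c).
have uac s : a <= s -> s < c -> u a <= u s.
  move=> as_ sc; have [t [_ tS] st] := sup_gt (ex_intro _ a Sa) sc.
  by apply: tS; rewrite as_ ltW.
have ucl s : s < c -> c - d < s -> u s <= u c.
  move=> sc ds; have := hd s; rewrite /ball /= => /(_ _)/wrap[].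
    by rewrite gtr0_norm ?subr_gt0 //; lra.
  by rewrite nmulr_lge0 ?subr_lt0 // subr_le0.
have ucr s : c < s -> s < c + d -> u c <= u s.
  move=> sc ds; have := hd s; rewrite /ball /= => /(_ _)/wrap[].
    by rewrite distrC gtr0_norm ?subr_gt0 //; lra.
  by rewrite pmulr_lge0 ?subr_gt0 // subr_ge0.
have d2 : 0 < d / 2 by rewrite divr_gt0.
have dd : d / 2 < d by rewrite gtr_pMr // invf_lt1 // ltr1n.
have uc : u a <= u c.
  move: ac; rewrite le_eqVlt => /predU1P[-> //|ac].
  pose s := Num.max a (c - d / 2).
  have sc : s < c by rewrite gt_max ac /= gtrBl.
  apply: (@le_trans _ _ (u s)); first by apply: uac; rewrite // le_max lexx.
  by apply: ucl; rewrite // lt_max ltrD2l ltrN2 dd orbT.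
move: (cb); rewrite le_eqVlt => /predU1P[<- //|cltb].
(* Below b the property at the supremum extends to the right. *)
exfalso; pose s := Num.min b (c + d / 2).
have cs : c < s by rewrite lt_min cltb /= ltrDl.
suff /(sup_upper_bound supS) : S s by rewrite leNgt cs.
split; first by rewrite ge_min lexx andbT (le_trans ac) // ltW.
move=> t /andP[a_t ts]; have [tc|ct|->//] := ltgtP t c; first exact: uac.
apply: le_trans uc _; apply: ucr => //; apply: le_lt_trans ts _.
by rewrite gt_min ltrD2l dd orbT.
Qed.

(** The local hypothesis loses a factor 1 - e; as e is arbitrary, nothing is
    lost globally. *)
Lemma locally_strongly_increasing (u : R -> R) (K a b : R) : 0 <= K ->
  (forall e t : R, 0 < e < 1 ->
    \forall s \near t, (1 - e) * K * (s - t) ^+ 2 <= (u s - u t) * (s - t)) ->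
  a <= b -> K * (b - a) <= u b - u a.
Proof.
move=> K0 loc ab.
have step e : 0 < e < 1 -> (1 - e) * (K * (b - a)) <= u b - u a.
  move=> e01; have := @locally_increasing (fun t => u t - (1 - e) * K * t) a b.
  move=> /(_ _ ab)/wrap[]; last lra.
  move=> t; near=> s.
  have : (1 - e) * K * (s - t) ^+ 2 <= (u s - u t) * (s - t).
    by near: s; exact: loc.
  by rewrite expr2; lra.
rewrite leNgt; apply/negP => lt.
have KB : 0 <= K * (b - a) by rewrite mulr_ge0 // subr_ge0.
have := step 2^-1; move=> /(_ _)/wrap[]; first by apply/andP; split; lra.
move=> half.
have KBp : 0 < K * (b - a) by lra.
have h2 : K * (b - a) - (u b - u a) < 2 * (K * (b - a)) by lra.
(* This e makes the loss half of the supposed deficit. *)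
pose e := (K * (b - a) - (u b - u a)) / (2 * (K * (b - a))).
have e0 : 0 < e by rewrite divr_gt0 ?subr_gt0 // mulr_gt0.
have e1 : e < 1 by rewrite ltr_pdivrMr ?mul1r // mulr_gt0.
have := step e; rewrite e0 e1 => /(_ isT).
rewrite mulrBl mul1r; have -> : e * (K * (b - a)) = (K * (b - a) - (u b - u a)) / 2.
  rewrite /e; move: (K * (b - a)) KBp => X X0; field.
  by rewrite gt_eqF.
lra.
Unshelve. all: by end_near. Qed.

(** The lower Riemann sums of u over n equal steps give
    u 0 + K (n - 1) / (2 n); let n tend to infinity. *)
Lemma riemann_lower_bound (g u : R -> R) (K : R) :
  (forall s t, u s * (t - s) <= g t - g s) ->
  (forall t, 0 <= t -> K * t <= u t - u 0) ->
  u 0 + K / 2 <= g 1 - g 0.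
Proof.
move=> gu uK; apply/ler_addgt0Pr => e e0.
have [n nP] : exists n : nat, `|K| / (2 * e) < n%:R.
  exists (Num.bound (`|K| / (2 * e))); apply: archi_boundP.
  by rewrite divr_ge0 // mulr_ge0 // ltW.
have n0 : 0 < n%:R :> R by apply: le_lt_trans nP; rewrite divr_ge0 // mulr_ge0 // ltW.
have nn0 : n%:R != 0 :> R by rewrite gt_eqF.
have tele j : (j%:R / n%:R) * u 0 + K / n%:R ^+ 2 * (j%:R * (j%:R - 1) / 2) <=
   g (j%:R / n%:R) - g 0.
  elim: j => [|j IH]; first by rewrite !mul0r mulr0 subrr addr0.
  have h1 := gu (j%:R / n%:R) (j.+1%:R / n%:R).
  have jn : 0 <= j%:R / n%:R :> R by rewrite divr_ge0 // ltW.
  have h2 := uK _ jn.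
  have dE : j.+1%:R / n%:R - j%:R / n%:R = n%:R^-1 :> R.
    by rewrite -mulrBl -natrB // subSnn mul1r.
  rewrite dE in h1.
  have nV : 0 <= n%:R^-1 :> R by rewrite invr_ge0 ltW.
  have h3 := ler_wpM2r nV h2.
  have -> : j.+1%:R / n%:R * u 0 + K / n%:R ^+ 2 * (j.+1%:R * (j.+1%:R - 1) / 2) =
    (j%:R / n%:R * u 0 + K / n%:R ^+ 2 * (j%:R * (j%:R - 1) / 2)) +
     (n%:R^-1 * u 0 + K * (j%:R / n%:R) / n%:R).
    by rewrite -natr1; field.
  lra.
have := tele n; rewrite divff // mul1r.
have -> : K / n%:R ^+ 2 * (n%:R * (n%:R - 1) / 2) = K / 2 - K / (2 * n%:R) by field.
have : K / (2 * n%:R) <= e.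
  rewrite ler_pdivrMr ?mulr_gt0 //.
  move: nP; rewrite ltr_pdivrMr ?mulr_gt0 // => nP.
  have := ler_norm K; lra.
lra.
Qed.

End LocalToGlobal.

(** * The mirror map *)

Section MirrorMap.
Variables (R : realType) (m k : nat).
Implicit Types (Q W V H M : 'M[R]_(m, k)) (p : R).

Definition mirror_scale p : R := (minn m k)%:R `^ (2 - 2 / p) / (p * (p - 1)).

(** With [schatten_grad] this is the chain rule for the mirror map as a power of
    the p-th power sum. *)
Definition mirror_weight p Q : R := mirror_scale p * schatten_sum p Q `^ (2 / p - 1).

Definition mirror_grad p Q : 'M[R]_(m, k) := mirror_weight p Q *: schatten_grad p Q.

Lemma mirror_scale_ge0 p : 1 < p -> 0 <= mirror_scale p.
Proof. by move=> p1; rewrite /mirror_scale divr_ge0 ?powR_ge0 // mulr_ge0; lra. Qed.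

Lemma mirror_weight_ge0 p Q : 1 < p -> 0 <= mirror_weight p Q.
Proof. by move=> p1; rewrite mulr_ge0 ?mirror_scale_ge0 ?powR_ge0. Qed.

Lemma mirror_mapE p Q : 1 < p ->
  mirror_map p Q = mirror_scale p * (p / 2) * schatten_sum p Q `^ (2 / p).
Proof.
move=> p1; rewrite /mirror_map /schatten_norm -schatten_sumE /mirror_scale.
rewrite -powR_mulrn ?powR_ge0 // -powRrM (mulrC p^-1).
by congr (_ * _); field; apply/andP; split; lra.
Qed.

Lemma schatten_grad_eq0 p Q : 1 < p -> schatten_sum p Q = 0 -> schatten_grad p Q = 0.
Proof.
move=> p1 Q0; have p0 : p != 0 by rewrite gt_eqF //; lra.
have es := dilation_basisP Q.
apply: frob_inner_eq0; rewrite schatten_gradE /spfun.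
suff -> : map_mx (sgpow (p - 1)) (dilation_eigenvalues Q) = 0.
  by rewrite linear0 mulmx0 mul0mx frob_inner0l mulr0.
apply/matrixP => i j; rewrite !mxE ord1.
move: Q0; rewrite (schatten_sum_dilation p0 es) => /eqP.
rewrite mulf_eq0 invr_eq0 pnatr_eq0 /= psumr_eq0 => [/allP/(_ j (mem_index_enum _))|l _].
  by rewrite /= powR_eq0 normr_eq0 => /andP[/eqP -> _]; rewrite sgpow0.
exact: powR_ge0.
Qed.

Lemma schatten_grad_monotone p H M : 1 < p ->
  0 <= frob_inner (schatten_grad p M - schatten_grad p H) (M - H).
Proof.
move=> p1; have c1 := schatten_sum_convex H M p1.
have c2 := schatten_sum_convex M H p1.
rewrite -opprB frob_innerNr in c2; rewrite frob_innerBl.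
move: c1 c2; move: (schatten_sum p H) (schatten_sum p M) => x y.
by move: (frob_inner _ _) (frob_inner _ _) => v w; lra.
Qed.

(** The mirror map is the convex power 2 / p of a convex function. *)
Lemma mirror_map_convex p H M : 1 < p < 2 ->
  mirror_map p H + frob_inner (mirror_grad p H) (M - H) <= mirror_map p M.
Proof.
move=> /andP[p1 p2]; rewrite !mirror_mapE // frob_innerZl /mirror_weight.
have p20 : 1 < 2 / p by rewrite ltr_pdivlMr ?mul1r //; lra.
have ph : 0 <= p / 2 by lra.
have p0 : p != 0 by rewrite gt_eqF //; lra.
have := powR_bregman_ge0 (schatten_sum p H) (schatten_sum p M) p20.
rewrite sgpow_ge0 ?schatten_sum_ge0 //; last by rewrite subr_eq0 gt_eqF.
rewrite !ger0_norm ?schatten_sum_ge0 // => /(mulr_ge0 ph) breg.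
have := mirror_scale_ge0 p1; move: (mirror_scale p) => c c0.
have := ler_wpM2l (powR_ge0 (schatten_sum p H) (2 / p - 1)) (schatten_sum_convex H M p1).
move: (schatten_sum p H) (schatten_sum p M) breg => sH sM.
move: (sM `^ _) (sH `^ (2 / p)) (sH `^ (2 / p - 1)) => y x w.
move: (frob_inner _ _) => g.
have -> : p / 2 * (y - x - 2 / p * (w * (sM - sH))) =
  p / 2 * (y - x) - w * (sM - sH) by field.
move=> breg conv; have := ler_wpM2l c0 conv; have := mulr_ge0 c0 breg; lra.
Qed.

Lemma schatten_grad_cvg p H V : 1 < p < 2 ->
  {for 0, continuous (fun h : R => frob_inner (schatten_grad p (H + h *: V)) V)}.
Proof.
move=> p12; have /andP[p1 p2] := p12.
set C := p * (2 * frob_inner V V + (m + k)%:R).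
have bound h : `|frob_inner (schatten_grad p (H + h *: V)) V -
    frob_inner (schatten_grad p H) V| <= C * `|h| `^ (p - 1).
  have [->|h0] := eqVneq h 0.
    by rewrite scale0r addr0 subrr normr0 powR0 ?mulr0 // subr_eq0 gt_eqF.
  have HV : H + h *: V - H = h *: V by rewrite addrC addKr.
  have hp : 0 < `|h| by rewrite normr_gt0.
  have := schatten_grad_holder H (H + h *: V) p12 hp.
  have := schatten_grad_monotone H (H + h *: V) p1.
  rewrite HV frob_innerBl !frob_innerZr !frob_innerZl -mulrBr.
  set x := frob_inner _ _ - frob_inner _ _ => hx0 hx.
  have hx' : `|h| * `|x| <= p * (`|h| `^ (p - 2) * (2 * (h * (h * frob_inner V V))) +
      `|h| `^ p * (m + k)%:R) by rewrite -normrM ger0_norm.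
  have pw2 : `|h| `^ (p - 2) * h ^+ 2 = `|h| `^ p.
    rewrite -real_normK ?num_real // -powR_mulrn // -powRD ?subrK //.
    by rewrite (gt_eqF hp) implybT.
  have pw1 : `|h| * `|h| `^ (p - 1) = `|h| `^ p.
    by rewrite mulr_powRB1 //; lra.
  rewrite -(ler_pM2l hp); apply: le_trans hx' _.
  rewrite le_eqVlt; apply/orP; left; apply/eqP.
  have -> : `|h| * (C * `|h| `^ (p - 1)) = C * (`|h| * `|h| `^ (p - 1)) by ring.
  rewrite pw1 /C -pw2; ring.
apply/cvgrPdist_le => e e0.
have : {for 0, continuous (fun h : R => C * `|h| `^ (p - 1))}.
  apply: cvgM; first exact: cvg_cst.
  by apply: continuous_powR_norm; lra.
move/cvgrPdist_le => /(_ e e0).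
rewrite normr0 powR0 ?mulr0; last by rewrite subr_eq0 gt_eqF.
apply: filterS => h; rewrite sub0r normrN scale0r addr0 => he.
rewrite distrC; apply: le_trans (bound h) _; apply: le_trans he; exact: ler_norm.
Qed.

Lemma schatten_sum_cvg p H V : 1 < p < 2 ->
  {for 0, continuous (fun h : R => schatten_sum p (H + h *: V))}.
Proof.
move=> p12; have /andP[p1 p2] := p12.
pose g h := frob_inner (schatten_grad p (H + h *: V)) V.
have gc : {for 0, continuous g} by exact: schatten_grad_cvg.
have lo : {for 0, continuous (fun h : R => schatten_sum p H + h * g 0)}.
  apply: cvgD; first exact: cvg_cst.
  by apply: cvgM; [exact: cvg_id|exact: cvg_cst].
have hi : {for 0, continuous (fun h : R => schatten_sum p H + h * g h)}.
  apply: cvgD; first exact: cvg_cst.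
  by apply: cvgM; [exact: cvg_id|exact: gc].
have lim0 h : schatten_sum p H + 0 * h = schatten_sum p (H + 0 *: V).
  by rewrite mul0r scale0r !addr0.
have lo' : (schatten_sum p H + h * g 0 @[h --> (0 : R)] -->
    schatten_sum p (H + 0 *: V))%classic by rewrite -(lim0 (g 0)); exact: lo.
have hi' : (schatten_sum p H + h * g h @[h --> (0 : R)] -->
    schatten_sum p (H + 0 *: V))%classic by rewrite -(lim0 (g 0)); exact: hi.
apply: squeeze_cvgr lo' hi'; near=> h; apply/andP; split.
  have := schatten_sum_convex H (H + h *: V) p1.
  by rewrite (addrC H) addrK frob_innerZr /g scale0r addr0.
have := schatten_sum_convex (H + h *: V) H p1.
have -> : H - (H + h *: V) = - (h *: V) by rewrite opprD addrA subrr add0r.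
by rewrite frob_innerNr frob_innerZr lerBlDr.
Unshelve. all: by end_near. Qed.

Lemma mirror_weight_cvg p H V : 1 < p < 2 ->
  {for 0, continuous (fun h : R => mirror_weight p (H + h *: V))}.
Proof.
move=> p12; have /andP[p1 p2] := p12.
have r0 : 0 < 2 / p - 1.
  by rewrite subr_gt0 ltr_pdivlMr ?mul1r //; lra.
have -> : (fun h : R => mirror_weight p (H + h *: V)) =
    (fun h => mirror_scale p * `|schatten_sum p (H + h *: V)| `^ (2 / p - 1)).
  by apply/funext => h; rewrite ger0_norm ?schatten_sum_ge0.
have h1 := @schatten_sum_cvg p H V p12.
have h2 := @continuous_powR_norm R _ r0 (schatten_sum p (H + 0 *: V)).
have h3 := continuous_comp h1 h2.
by apply: cvgM; [exact: cvg_cst|exact: h3].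
Qed.

Lemma mirror_grad_cvg p H V : 1 < p < 2 ->
  {for 0, continuous (fun h : R => frob_inner (mirror_grad p (H + h *: V)) V)}.
Proof.
move=> p12.
have -> : (fun h : R => frob_inner (mirror_grad p (H + h *: V)) V) =
   (fun h => mirror_weight p (H + h *: V) * frob_inner (schatten_grad p (H + h *: V)) V).
  by apply/funext => h; rewrite frob_innerZl.
by apply: cvgM; [exact: mirror_weight_cvg|exact: schatten_grad_cvg].
Qed.

Lemma gradient_mirror_map p H : 1 < p < 2 ->
  gradient (mirror_map p) H = mirror_grad p H.
Proof.
move=> p12; apply: convex_gradient => [{}H M|V]; first exact: mirror_map_convex.
exact: mirror_grad_cvg.
Qed.

(** If the sum is larger at M, so is the weight there, and <grad, M - H> is
    nonnegative at M by convexity; the change of weight only helps. *)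
Lemma mirror_grad_monotone_min p H M : 1 < p < 2 ->
  Num.min (mirror_weight p H) (mirror_weight p M) *
    frob_inner (schatten_grad p M - schatten_grad p H) (M - H) <=
  frob_inner (mirror_grad p M - mirror_grad p H) (M - H).
Proof.
move=> /andP[p1 p2].
have r0 : 0 <= 2 / p - 1.
  by rewrite subr_ge0 ler_pdivlMr ?mul1r //; lra.
have weight_le (x y a b : R) : 0 <= b -> x <= y -> x * (b - a) <= y * b - x * a.
  by move=> b0 xy; have := ler_wpM2r b0 xy; lra.
wlog HM : H M / schatten_sum p H <= schatten_sum p M => [hw|].
  have [|/ltW] := leP (schatten_sum p H) (schatten_sum p M); first exact: hw.
  move=> MH; rewrite minC.
  rewrite (frob_inner_swap (schatten_grad p M)).
  rewrite (frob_inner_swap (mirror_grad p M)).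
  exact: hw MH.
have wle : mirror_weight p H <= mirror_weight p M.
  apply: ler_wpM2l; first exact: mirror_scale_ge0.
  by apply: ge0_ler_powR HM => //; rewrite nnegrE; exact: schatten_sum_ge0.
rewrite min_l // /mirror_grad frob_innerBl [leRHS]frob_innerBl !frob_innerZl.
have h0 : 0 <= frob_inner (schatten_grad p M) (M - H).
  have := schatten_sum_convex M H p1; rewrite -opprB frob_innerNr.
  by rewrite lerBlDr -lerBlDl => h; apply: le_trans h; rewrite subr_ge0.
exact: weight_le.
Qed.

Lemma dual_exponent p (q := p / (p - 1)) : 1 < p < 2 ->
  [/\ 2 < q, p^-1 + q^-1 = 1, 2 / p - 1 = 1 - 2 / q & 2 - 2 / p = 1 - (2 / p - 1)].
Proof.
move=> /andP[p1 p2]; split.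
- by rewrite ltr_pdivlMr; lra.
- by rewrite /q; field; apply/andP; split; lra.
- by rewrite /q; field; apply/andP; split; lra.
- by field; lra.
Qed.

(** The powers of the dimension in the mirror map cancel those coming from
    [schatten_grad_strong].  Together with [mirror_grad_monotone_min] this is
    strong monotonicity up to the ratio of the two weights. *)
Lemma mirror_grad_local p W H M : 1 < p < 2 ->
  frob_inner W (M - H) ^+ 2 <= spectral_norm W ^+ 2 *
    (Num.max (mirror_weight p H) (mirror_weight p M) *
     frob_inner (schatten_grad p M - schatten_grad p H) (M - H)).
Proof.
move=> p12; have /andP[p1 p2] := p12.
have [q2 pq rE sE] := dual_exponent p12.
have := schatten_grad_strong W H M p1 q2 pq rE.
rewrite -sE -/(mirror_scale p) -mulrA => /le_trans; apply.
rewrite ler_wpM2l ?sqr_ge0 // ler_wpM2r ?schatten_grad_monotone //.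
have [_|_] := leP (schatten_sum p H) (schatten_sum p M).
  change (mirror_weight p M <= Num.max (mirror_weight p H) (mirror_weight p M)).
  by rewrite le_max lexx orbT.
change (mirror_weight p H <= Num.max (mirror_weight p H) (mirror_weight p M)).
by rewrite le_max lexx.
Qed.

Lemma relative_min_max (e x y : R) : 0 < e < 1 -> 0 < x -> 0 <= y ->
  x - x * (e / 2) <= y <= x + x * (e / 2) ->
  (1 - e) * Num.max x y <= Num.min x y.
Proof.
move=> /andP[e0 e1] x0 y0 /andP[h1 h2].
have xe : 0 < x * e by rewrite mulr_gt0.
have xee : 0 <= x * (e * e) by rewrite !mulr_ge0 // ltW.
have xee1 : x * (e * e) <= x * e by rewrite ler_pM2l // ger_pMl // ltW.
have ye : 0 <= y * e by rewrite mulr_ge0 // ltW.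
have h3 := ler_wpM2l (ltW e0) h1; have h4 := ler_wpM2l (ltW e0) h2.
by have [hle|hlt] := leP x y; lra.
Qed.

(** Along the segment from H to M the derivative u of the mirror map increases
    locally at a rate arbitrarily close to <W, M - H>^2 / |W|^2, since the
    weights are continuous; this is made global and then integrated. *)
Lemma mirror_map_strongly_convex p W H M : 1 < p < 2 ->
  frob_inner W (M - H) ^+ 2 <= spectral_norm W ^+ 2 *
    (2 * (mirror_map p M - mirror_map p H - frob_inner (mirror_grad p H) (M - H))).
Proof.
move=> p12; have /andP[p1 p2] := p12.
have r0 : 0 < 2 / p - 1.
  by rewrite subr_gt0 ltr_pdivlMr ?mul1r //; lra.
have conv A B := @mirror_map_convex p A B p12.
have [w0|w0] := eqVneq (spectral_norm W ^+ 2) 0.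
  by have := mirror_grad_local W H M p12; rewrite w0 !mul0r.
have wp : 0 < spectral_norm W ^+ 2 by rewrite lt_def w0 sqr_ge0.
set V := M - H.
pose K := frob_inner W V ^+ 2 / spectral_norm W ^+ 2.
have K0 : 0 <= K by rewrite divr_ge0 ?sqr_ge0.
pose X t := H + t *: V; pose u t := frob_inner (mirror_grad p (X t)) V.
have XX s t : X s - X t = (s - t) *: V.
  by rewrite /X opprD addrACA subrr add0r scalerBl.
have uE s t : (u s - u t) * (s - t) =
    frob_inner (mirror_grad p (X s) - mirror_grad p (X t)) (X s - X t).
  by rewrite XX frob_innerZr frob_innerBl mulrC.
have uK a b : a <= b -> K * (b - a) <= u b - u a.
  apply: locally_strongly_increasing => // e t /andP[e0 e1].
  pose g s := frob_inner (schatten_grad p (X s) - schatten_grad p (X t)) (X s - X t).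
  have loc s : K * (s - t) ^+ 2 <=
      Num.max (mirror_weight p (X t)) (mirror_weight p (X s)) * g s.
    have := mirror_grad_local W (X t) (X s) p12.
    rewrite {1}XX frob_innerZr exprMn -/(g s) => h.
    rewrite /K mulrAC ler_pdivrMr // mulrC (mulrC _ (spectral_norm W ^+ 2)).
    exact: h.
  have g0 s : 0 <= g s by exact: schatten_grad_monotone.
  have umin s := mirror_grad_monotone_min (X t) (X s) p12.
  (* Where the segment meets 0 the weight at t vanishes; only the weight at s
     enters then, and nothing is lost. *)
  have [Xt0|Xt0] := eqVneq (schatten_sum p (X t)) 0.
    have gt0 := schatten_grad_eq0 p1 Xt0.
    have wt0 : mirror_weight p (X t) = 0.
      by rewrite /mirror_weight Xt0 powR0 ?mulr0 // gt_eqF.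
    near=> s.
    apply: (@le_trans _ _ (K * (s - t) ^+ 2)).
      by rewrite ler_wpM2r ?sqr_ge0 // ler_piMl // gerBl ltW.
    apply: le_trans (loc s) _.
    rewrite wt0 max_r ?mirror_weight_ge0 // uE /g gt0 /mirror_grad wt0 gt0.
    by rewrite scaler0 !subr0 frob_innerZl.
  have sp : 0 < schatten_sum p (X t) by rewrite lt_def Xt0 schatten_sum_ge0.
  have cp : 0 <= mirror_scale p by exact: mirror_scale_ge0.
  have wcont : {for 0, continuous (fun h : R => mirror_weight p (X t + h *: V))}.
    exact: mirror_weight_cvg.
  set wt := mirror_weight p (X t).
  have wt0 : 0 <= wt by exact: mirror_weight_ge0.
  have near_w : \forall s \near t, (1 - e) * Num.max wt (mirror_weight p (X s)) <=
      Num.min wt (mirror_weight p (X s)).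
    move: wt0; rewrite le_eqVlt => /predU1P[wt0|wtp].
      have c0 : mirror_scale p = 0.
        apply/eqP; move/eqP: wt0; rewrite eq_sym mulf_eq0 powR_eq0 (negbTE Xt0) /=.
        by rewrite orbF.
      near=> s; rewrite -wt0.
      have -> : mirror_weight p (X s) = 0 by rewrite /mirror_weight c0 mul0r.
      by rewrite maxxx minxx mulr0.
    move/cvgrPdist_le : wcont => /(_ (wt * (e / 2))).
    rewrite scale0r addr0 -/wt => /(_ _)/wrap[].
      by rewrite mulr_gt0 // divr_gt0.
    move=> /nbhs_ballP[d /= d0 hd]; apply/nbhs_ballP; exists d => //= s ts.
    have := hd (s - t); rewrite /ball /= sub0r normrN distrC => /(_ ts).
    have -> : X t + (s - t) *: V = X s by rewrite /X -addrA -scalerDl [t + _]addrC subrK.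
    rewrite distrC ler_distl.
    apply: relative_min_max => //; first by rewrite e0.
    exact: mirror_weight_ge0.
  near=> s.
  have hw : (1 - e) * Num.max wt (mirror_weight p (X s)) <=
      Num.min wt (mirror_weight p (X s)) by near: s; exact: near_w.
  rewrite -mulrA uE; apply: le_trans (umin s).
  have e10 : 0 <= 1 - e by rewrite subr_ge0 ltW.
  apply: le_trans (ler_wpM2l e10 (loc s)) _.
  by rewrite mulrA ler_wpM2r.
have gu s t : u s * (t - s) <= mirror_map p (X t) - mirror_map p (X s).
  by have := conv (X s) (X t); rewrite XX frob_innerZr -/(u s) -lerBrDl mulrC.
(* Integrate the increase of u; this produces the factor 2. *)
have := riemann_lower_bound gu (K := K).
move=> /(_ _)/wrap[].
  by move=> t t0; have := uK 0 t t0; rewrite subr0.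
have -> : X 1 = M by rewrite /X scale1r /V addrC subrK.
have X0 : X 0 = H by rewrite /X scale0r addr0.
rewrite /u X0 => low.
have KE : frob_inner W V ^+ 2 = spectral_norm W ^+ 2 * K.
  by rewrite /K mulrC divfK.
rewrite KE; apply: ler_wpM2l; first exact: ltW wp.
by rewrite -ler_pdivrMl // mulrC lerBrDl.
Unshelve. all: by end_near. Qed.

End MirrorMap.

(** * Attainment of the conjugate *)

(** Here z is the squared norm of a slope Z, x that of a matrix, y their
    pairing: outside a ball whose radius depends on z only, a function with
    quadratic growth dominates the linear one. *)
Lemma linear_below_quadratic (R : realType) (f x y z : R) : 0 <= z ->
  x <= 2 * f -> y ^+ 2 <= z * x -> (z + 1 + 1) ^+ 2 <= x -> 0 <= f - y.
Proof.
move=> z0 lo cs big; have zz := mulr_ge0 z0 z0.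
rewrite expr2 in big.
have big' : 4 * z <= x by lra.
have x0 : 0 <= x by lra.
rewrite leNgt; apply/negP => fy; have xy : x / 2 < y by lra.
have : (x / 2) ^+ 2 < y ^+ 2 by rewrite ltr_sqr ?nnegrE //; lra.
have := ler_wpM2r x0 big'; move: cs; rewrite !expr2; lra.
Qed.

Section Minimizer.
Variables (R : realType) (m k : nat).
Implicit Types (H M Q V Z : 'M[R]_(m, k)).

Lemma frob_inner_sqr_bound H V : `|frob_inner H V| <= (frob_inner H H + frob_inner V V) / 2.
Proof.
have h1 := frob_inner_ge0 (H - V); have h2 := frob_inner_ge0 (H + V).
move: h1 h2; rewrite !frob_innerBl !frob_innerBr !frob_innerDl !frob_innerDr.
rewrite (frob_innerC V H) ler_norml.
move: (frob_inner H H) (frob_inner V V) (frob_inner H V) => x y z h1 h2.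
by apply/andP; split; lra.
Qed.

Lemma frob_inner_vec_mx (v : 'rV[R]_(m * k)) :
  frob_inner (vec_mx v) (vec_mx v) = \sum_i v 0 i ^+ 2.
Proof.
rewrite frob_innerE pair_bigA /=.
rewrite (reindex (uncurry (@mxvec_index m k))) /=; last exact: curry_mxvec_bij.
by apply: eq_bigr => -[i j] _; rewrite !mxE expr2.
Qed.

Variables (F : 'M[R]_(m, k) -> R) (G : 'M[R]_(m, k) -> 'M[R]_(m, k)) (C : R).
Hypothesis convF : forall H M, F H + frob_inner (G H) (M - H) <= F M.
Hypothesis upF : forall Q, F Q <= C * frob_inner Q Q.
Hypothesis loF : forall Q, frob_inner Q Q <= 2 * F Q.

Lemma convex_interpolate H V (t : R) : 0 <= t <= 1 ->
  F (H + t *: V) - F H <= t * (F (H + V) - F H).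
Proof.
move=> /andP[t0 t1]; set X := H + t *: V.
have h1 := convF X H; have h2 := convF X (H + V).
have e1 : H - X = - (t *: V) by rewrite /X opprD addrA subrr add0r.
have e2 : H + V - X = (1 - t) *: V.
  by rewrite /X opprD addrACA subrr add0r scalerBl scale1r.
rewrite e1 frob_innerNr frob_innerZr in h1; rewrite e2 frob_innerZr in h2.
move: h1 h2; move: (frob_inner _ _) (F X) (F H) (F (H + V)) => g x h y h1 h2.
have := ler_wpM2l t0 h2; have t10 : 0 <= 1 - t by rewrite subr_ge0.
have := ler_wpM2l t10 h1; clear -t0 t1; lra.
Qed.

(** The upper estimate of F near H comes from interpolation between H and a
    point at distance 1, the lower one from the subgradient at H. *)
Lemma convex_vec_mx_continuous Z :
  continuous (fun v : 'rV[R]_(m * k) => F (vec_mx v) - frob_inner Z (vec_mx v)).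
Proof.
move=> v; set H := vec_mx v; set N : R := (m * k)%:R.
pose K := `|C| * (2 * frob_inner H H + 2 * N) +
  (frob_inner (G H) (G H) + N) / 2 + (frob_inner Z Z + N) / 2.
have N0 : 0 <= N by rewrite ler0n.
have K0 : 0 <= K.
  by rewrite /K !addr_ge0 ?mulr_ge0 ?addr_ge0 ?mulr_ge0 ?frob_inner_ge0 ?invr_ge0.
apply/(@cvgrPdist_le _ _ _ (nbhs v) (nbhs_filter v)) => e e0.
(* Within distance 1 the increment is at most K times the distance. *)
have d0 : 0 < Num.min 1 (e / (K + 1)).
  by rewrite lt_min ltr01 divr_gt0 // ltr_wpDl.
apply: (iffRL (@nbhs_normP R 'rV[R]_(m * k) v _)); exists (Num.min 1 (e / (K + 1))) => // w /= /ltW.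
rewrite le_min distrC => /andP[t1 te].
set t := `|w - v| in t1 te.
have [t0|tn0] := eqVneq t 0.
  by move/normr0_eq0/eqP : t0; rewrite subr_eq0 => /eqP ->; rewrite subrr normr0 ltW.
have tp : 0 < t by rewrite lt_def tn0 normr_ge0.
pose u := t^-1 *: (w - v); pose V : 'M[R]_(m, k) := vec_mx u.
have wE : vec_mx w = H + t *: V.
  rewrite /V /u linearZ /= scalerA divff // scale1r /H -raddfD /=.
  by rewrite addrC subrK.
have VN : frob_inner V V <= N.
  rewrite frob_inner_vec_mx; apply: (@le_trans _ _ (\sum_(i < m * k) 1)); last first.
    by rewrite sumr_const card_ord.
  apply: ler_sum => i _; rewrite -real_normK ?num_real // expr_le1 //.
  rewrite /u mxE normrM normfV (gtr0_norm tp) mulrC ler_pdivrMr // mul1r /t.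
  rewrite -[w - v]opprB mxE normrN [leRHS]/Num.Def.normr /= mx_normrE.
  by apply/bigmax_geP; right; exists (0, i) => //=; rewrite [X in _ <= `|X|]mxE normrN.
have up : F (H + t *: V) - F H <= t * (`|C| * (2 * frob_inner H H + 2 * N)).
  have t01 : 0 <= t <= 1 by rewrite (ltW tp).
  apply: le_trans (convex_interpolate H V t01) _; rewrite ler_wpM2l ?(ltW tp) //.
  have FH : 0 <= F H.
    by rewrite -(pmulr_rge0 _ (ltr0n R 2)); apply: le_trans (loF H); exact: frob_inner_ge0.
  apply: (@le_trans _ _ (F (H + V))); first by rewrite gerBl.
  apply: le_trans (upF _) _; apply: le_trans (ler_wpM2r (frob_inner_ge0 _) (ler_norm C)) _.
  rewrite ler_wpM2l // frob_innerDl !frob_innerDr (frob_innerC V H).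
  have := le_trans (ler_norm _) (frob_inner_sqr_bound H V).
  move: VN; move: (frob_inner H H) (frob_inner V V) (frob_inner H V).
  by clear => x y z h1 h2; lra.
have lo : - (t * ((frob_inner (G H) (G H) + N) / 2)) <= F (H + t *: V) - F H.
  have h := convF H (H + t *: V); have e1 : H + t *: V - H = t *: V by rewrite addrC addKr.
  rewrite e1 frob_innerZr addrC -lerBrDr in h; apply: le_trans h.
  rewrite -mulrN ler_wpM2l ?(ltW tp) // lerNl.
  apply: le_trans (le_trans (ler_norm _) _) _; last first; last first.
  - by rewrite normrN; exact: frob_inner_sqr_bound.
  - by rewrite ler_wpM2r ?invr_ge0 // lerD2l.
have zb : `|frob_inner Z V| <= (frob_inner Z Z + N) / 2.
  apply: le_trans (frob_inner_sqr_bound Z V) _.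
  by rewrite ler_wpM2r ?invr_ge0 // lerD2l.
rewrite wE frob_innerDr frob_innerZr distrC.
have tK : t * K <= e.
  move: te; rewrite ler_pdivlMr ?ltr_wpDl // => te.
  by apply: le_trans te; rewrite ler_wpM2l ?(ltW tp) // lerDl.
apply: le_trans tK; rewrite /K.
move: up lo zb; rewrite !ler_norml.
have c1 : 0 <= `|C| * (2 * frob_inner H H + 2 * N).
  by rewrite mulr_ge0 // addr_ge0 // mulr_ge0 // frob_inner_ge0.
have c2 : 0 <= (frob_inner (G H) (G H) + N) / 2.
  by rewrite divr_ge0 // addr_ge0 // frob_inner_ge0.
move: c1 c2; move: (_ * _ + _ * _) => aux.
move: (`|C| * aux) ((frob_inner (G H) (G H) + N) / 2) => a b.
move: ((frob_inner Z Z + N) / 2) (frob_inner Z V) (frob_inner Z H) (F (H + t *: V)) (F H).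
move: tp; clear => tp z y x f h a0 b0 h1 h2 /andP[h3 h4].
have ta := mulr_ge0 (ltW tp) a0; have tb := mulr_ge0 (ltW tp) b0.
have := ler_wpM2l (ltW tp) h3; have := ler_wpM2l (ltW tp) h4.
by move=> h5 h6; apply/andP; split; lra.
Qed.

Lemma convex_conjugate_attained Z :
  exists Q, forall M, F Q + frob_inner Z (M - Q) <= F M.
Proof.
pose g (v : 'rV[R]_(m * k)) := F (vec_mx v) - frob_inner Z (vec_mx v).
(* Outside the box of half-width r the function exceeds its value at 0. *)
pose r := frob_inner Z Z + 1 + 1.
have zz := frob_inner_ge0 Z.
pose A := [set v : 'rV[R]_(m * k) | forall i, `[- r, r]%classic (v ord0 i)]%classic.
have cA : compact A.
  by apply: (@rV_compact _ _ (fun=> `[- r, r]%classic)) => _; exact: segment_compact.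
have A0 : A 0.
  by move=> i; rewrite /= mxE in_itv /=; apply/andP; split; rewrite /r; lra.
have F0 : F 0 = 0.
  apply/le_anti; have := upF 0; have := loF 0.
  by rewrite frob_inner0r mulr0 pmulr_rge0 // => -> ->.
have [c _ cmin] : exists2 c, c \in A & forall v, v \in A -> g c <= g v.
  apply: compact_EVT_min => //; first by exists 0.
  exact/continuous_subspaceT/convex_vec_mx_continuous.
have gmin v : g c <= g v.
  have [vA|vA] := pselect (A v); first by apply: cmin; rewrite inE.
  apply: (@le_trans _ _ (g 0)); first by apply: cmin; rewrite inE.
  rewrite /g linear0 F0 frob_inner0r subrr.
  have [i vi] : exists i, ~ `[- r, r]%classic (v ord0 i).
    by apply/existsNP.
  have big : r ^+ 2 <= frob_inner (vec_mx v) (vec_mx v : 'M[R]_(m, k)).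
    rewrite frob_inner_vec_mx (bigD1 i) //=.
    apply: ler_wpDr; first by apply: sumr_ge0 => j _; rewrite sqr_ge0.
    rewrite -[leRHS]real_normK ?num_real // ler_sqr ?nnegrE //; last by rewrite /r; lra.
    rewrite leNgt; apply/negP => lt; apply: vi => /=.
    by rewrite in_itv /= -ler_norml ltW.
  exact: (linear_below_quadratic zz (loF _) (frob_inner_cauchy Z _) big).
exists (vec_mx c) => M; have := gmin (mxvec M); rewrite /g mxvecK frob_innerBr.
by move: (F _) (F _) (frob_inner _ _) (frob_inner _ _) => a b x y; lra.
Qed.

End Minimizer.

(** * The conjugate of the mirror map *)

Section MirrorConjugate.
Variables (R : realType) (m k : nat).
Implicit Types (Q W V H M X Y Z : 'M[R]_(m, k)) (p : R).

Lemma schatten_sum_le_rank p Q : 0 < p ->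
  schatten_sum p Q <= (\rank Q)%:R * spectral_norm Q `^ p.
Proof.
move=> p0; rewrite schatten_sumE.
apply: (@sum_singular_values_le _ _ _ Q (fun x : R => x `^ p)).
  by rewrite powR0 // gt_eqF.
by move=> x y x0 y0 xy; apply: ge0_ler_powR => //; exact: ltW.
Qed.

(** At most s singular values are nonzero, each at most the spectral norm. *)
Lemma schatten_sum_powR_le p Q (s : nat) : 0 < p -> (\rank Q <= s)%N ->
  schatten_sum p Q `^ (2 / p) <= s%:R `^ (2 / p) * spectral_norm Q ^+ 2.
Proof.
move=> p0 rk; have w0 := spectral_norm_ge0 Q.
have p20 : 0 <= 2 / p by rewrite divr_ge0 // ltW.
have -> : spectral_norm Q ^+ 2 = (spectral_norm Q `^ p) `^ (2 / p).
  by rewrite -powRrM mulrC divfK ?gt_eqF // powR_mulrn.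
rewrite -powRM ?powR_ge0 //.
apply: ge0_ler_powR => //; rewrite ?nnegrE.
- exact: schatten_sum_ge0.
- by rewrite mulr_ge0 ?powR_ge0.
apply: le_trans (schatten_sum_le_rank Q p0) _.
by rewrite ler_wpM2r ?powR_ge0 // ler_nat.
Qed.

Lemma spectral_norm_sqr_le Q : spectral_norm Q ^+ 2 <= frob_inner Q Q.
Proof.
rewrite -[leRHS]sqr_sqrtr ?frob_inner_ge0 // ler_sqr ?nnegrE ?spectral_norm_ge0 ?sqrtr_ge0 //.
apply: bigmax_le => [|j _]; first exact: sqrtr_ge0.
rewrite -(ger0_norm (singular_values_ge0 Q j)) -sqrtr_sqr; apply: ler_wsqrtr.
rewrite frob_inner_singular_values (bigD1 j) //= lerDl.
by apply: sumr_ge0 => i _; rewrite sqr_ge0.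
Qed.

Lemma schatten_sum0 p : p != 0 -> schatten_sum p (0 : 'M[R]_(m, k)) = 0.
Proof.
move=> p0; rewrite schatten_sumE big1 // => j _.
have /eqP : frob_inner (0 : 'M[R]_(m, k)) 0 = 0 by rewrite frob_inner0r.
rewrite frob_inner_singular_values psumr_eq0 => [/allP/(_ j (mem_index_enum _))|i _].
  by rewrite /= sqrf_eq0 => /eqP ->; rewrite powR0.
exact: sqr_ge0.
Qed.

Lemma mirror_map0 p : 1 < p -> mirror_map p (0 : 'M[R]_(m, k)) = 0.
Proof.
move=> p1; have p0 : 0 < p by lra.
rewrite mirror_mapE // schatten_sum0 ?gt_eqF // powR0 ?mulr0 //.
by rewrite gt_eqF // divr_gt0.
Qed.

Lemma mirror_grad0 p : 1 < p -> mirror_grad p (0 : 'M[R]_(m, k)) = 0.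
Proof.
move=> p1; rewrite /mirror_grad schatten_grad_eq0 ?scaler0 //.
by rewrite schatten_sum0 // gt_eqF //; lra.
Qed.

(** Strong convexity between 0 and Q, tested with W = Q. *)
Lemma mirror_map_lower p Q : 1 < p < 2 -> frob_inner Q Q <= 2 * mirror_map p Q.
Proof.
move=> p12; have /andP[p1 p2] := p12.
have := mirror_map_strongly_convex Q 0 Q p12.
rewrite mirror_map0 // mirror_grad0 // frob_inner0l !subr0 => sc.
have [->|Q0] := eqVneq Q 0; first by rewrite frob_inner0r mirror_map0 ?mulr0.
have f0 : 0 <= mirror_map p Q.
  by have := mirror_map_convex 0 Q p12; rewrite mirror_map0 // mirror_grad0 // frob_inner0l addr0.
have qp : 0 < frob_inner Q Q.
  by rewrite lt_def frob_inner_ge0 andbT; apply: contraNneq Q0 => /frob_inner_eq0 ->.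
rewrite -(ler_pM2l qp) -expr2; apply: le_trans sc _.
by apply: ler_wpM2r; [rewrite mulr_ge0|exact: spectral_norm_sqr_le].
Qed.

Lemma mirror_map_upper p : 1 < p ->
  exists C, forall Q, mirror_map p Q <= C * frob_inner Q Q.
Proof.
move=> p1; have p0 : 0 < p by lra.
exists (mirror_scale m k p * (p / 2) * m%:R `^ (2 / p)) => Q.
rewrite mirror_mapE // -[leRHS]mulrA; apply: ler_wpM2l.
  by rewrite mulr_ge0 ?mirror_scale_ge0 // divr_ge0 // ltW.
apply: le_trans (schatten_sum_powR_le p0 (rank_leq_row Q)) _.
by apply: ler_wpM2l; [exact: powR_ge0|exact: spectral_norm_sqr_le].
Qed.

Lemma mirror_conjugate_attained p Z : 1 < p < 2 ->
  exists Q, forall M, mirror_map p Q + frob_inner Z (M - Q) <= mirror_map p M.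
Proof.
move=> p12; have [p1 p2] := andP p12; have [C up] := mirror_map_upper p1.
apply: (@convex_conjugate_attained _ _ _ _ (mirror_grad p) C).
- by move=> H M; exact: mirror_map_convex.
- exact: up.
- by move=> Q; exact: mirror_map_lower.
Qed.

(** Strong convexity gives both divergences between M and H, and their sum is the
    pairing of the difference of gradients with M - H. *)
Lemma bregman_two_sided p W H M (h : R) : 1 < p < 2 ->
  mirror_grad p M - mirror_grad p H = h *: W ->
  frob_inner W (M - H) ^+ 2 <=
    2 * spectral_norm W ^+ 2 * (h * frob_inner W (M - H)).
Proof.
move=> p12 gW; have := mirror_map_strongly_convex W H M p12.
have := mirror_map_convex M H p12.
have -> : mirror_grad p M = mirror_grad p H + h *: W by rewrite -gW addrC subrK.
rewrite -(opprB M H) frob_innerNr frob_innerDl frob_innerZl.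
move: (mirror_map p M) (mirror_map p H) (spectral_norm W ^+ 2) (sqr_ge0 (spectral_norm W)).
move: (frob_inner (mirror_grad p H) _) (frob_inner W _) => a b f g w w0 h1 h2.
apply: le_trans h2 _; rewrite [2 * w]mulrC -mulrA; apply: ler_wpM2l => //.
by rewrite ler_pM2l //; lra.
Qed.

(** Smoothness dual to strong convexity.  With y = <W, Y - X>, the two divergences
    add up to h y, and the reversed one is at least y^2 / (2 |W|^2); then
    h y - y^2 / (2 |W|^2) is at most h^2 |W|^2 / 2. *)
Lemma bregman_smooth p W X Y (h : R) : 1 < p < 2 ->
  mirror_grad p Y - mirror_grad p X = h *: W ->
  mirror_map p Y - mirror_map p X - frob_inner (mirror_grad p X) (Y - X) <=
    h ^+ 2 * spectral_norm W ^+ 2 / 2.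
Proof.
move=> p12 gW; have := mirror_map_strongly_convex W Y X p12.
have := mirror_map_convex Y X p12.
have -> : mirror_grad p Y = mirror_grad p X + h *: W by rewrite -gW addrC subrK.
rewrite -(opprB Y X) !frob_innerNr frob_innerDl frob_innerZl sqrrN.
move: (mirror_map p Y) (mirror_map p X) (spectral_norm W ^+ 2) (sqr_ge0 (spectral_norm W)).
move: (frob_inner (mirror_grad p X) _) (frob_inner W _) => a b f g w w0 h1 h2.
have [wz|wn0] := eqVneq w 0.
  have b0 : b = 0.
    apply/eqP; rewrite -sqrf_eq0; apply/eqP/le_anti; rewrite sqr_ge0 andbT.
    by move: h2; rewrite wz mul0r.
  by rewrite wz mulr0 mul0r; rewrite b0 in h1; lra.
have wp : 0 < w by rewrite lt_def wn0.
have sq := sqr_ge0 (b - h * w).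
rewrite -(ler_pM2l wp).
have -> : w * (h ^+ 2 * w / 2) = (h * w) ^+ 2 / 2 by field.
move: sq h2; rewrite !expr2; lra.
Qed.

Lemma fenchel_mirror_mapE p Z Q :
  (forall M, mirror_map p Q + frob_inner Z (M - Q) <= mirror_map p M) ->
  fenchel_conj (mirror_map p) Z = frob_inner Z Q - mirror_map p Q.
Proof.
move=> Qmax; rewrite /fenchel_conj; set S := (X in sup X).
have ubS : ubound S (frob_inner Z Q - mirror_map p Q).
  move=> _ [M _ <-]; have := Qmax M; rewrite frob_innerBr.
  by move: (frob_inner Z M) (frob_inner Z Q) (mirror_map p M) (mirror_map p Q) => a b c e; lra.
have SQ : S (frob_inner Z Q - mirror_map p Q) by exists Q.
have S0 : (S !=set0)%classic by exists (frob_inner Z Q - mirror_map p Q).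
apply/le_anti/andP; split; first exact: sup_le_ub.
by apply: sup_upper_bound => //; split; last by exists (frob_inner Z Q - mirror_map p Q).
Qed.

(** The maximizer G Z in the definition of the conjugate satisfies
    grad f (G Z) = Z, and G is a choice of subgradients of the conjugate.  By
    [bregman_two_sided] it is Lipschitz along lines, so it is the gradient. *)
Lemma mirror_grad_fenchel p Z : 1 < p < 2 ->
  mirror_grad p (gradient (fenchel_conj (mirror_map p)) Z) = Z.
Proof.
move=> p12.
pose G Z' := projT1 (cid (mirror_conjugate_attained Z' p12)).
have GP Z' : forall M, mirror_map p (G Z') + frob_inner Z' (M - G Z') <= mirror_map p M.
  exact: projT2 (cid (mirror_conjugate_attained Z' p12)).
have gradG Z' : mirror_grad p (G Z') = Z'.
  apply/esym/(@convex_subgradient_unique _ _ _ (mirror_map p)).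
  - by move=> H M; exact: mirror_map_convex.
  - by move=> V; exact: mirror_grad_cvg.
  - exact: GP.
rewrite (@convex_gradient _ _ _ _ G); [exact: gradG|move=> H M|move=> V].
  rewrite !(fenchel_mirror_mapE (GP _)).
  have := GP M (G H); rewrite !frob_innerBr.
  rewrite (frob_innerC (G H) M) (frob_innerC (G H) H).
  move: (mirror_map p (G M)) (mirror_map p (G H)) (frob_inner M (G M)) => a b c.
  by move: (frob_inner M (G H)) (frob_inner H (G H)) => x y; lra.
set w := spectral_norm V ^+ 2.
have w0 : 0 <= w by exact: sqr_ge0.
have lip h : `|frob_inner (G (Z + h *: V)) V - frob_inner (G Z) V| <= 2 * w * `|h|.
  have gE : mirror_grad p (G (Z + h *: V)) - mirror_grad p (G Z) = h *: V.
    by rewrite !gradG addrC addKr.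
  rewrite -frob_innerBl frob_innerC; have := bregman_two_sided p12 gE; rewrite -/w.
  move: (frob_inner V _) => x hx.
  have [->|x0] := eqVneq x 0; first by rewrite normr0; do 2![apply: mulr_ge0 => //].
  have xp : 0 < `|x| by rewrite normr_gt0.
  rewrite -(ler_pM2r xp) -expr2 real_normK ?num_real //.
  apply: le_trans hx _; rewrite -[leRHS]mulrA -normrM.
  by apply: ler_wpM2l; [rewrite mulr_ge0|exact: ler_norm].
apply/cvgrPdist_le => e e0; rewrite scale0r addr0.
have lim : {for 0, continuous (fun h : R => 2 * w * `|h|)}.
  apply: cvgM; first exact: cvg_cst.
  exact: (@norm_continuous R R^o).
move/cvgrPdist_le : lim => /(_ e e0); apply: filterS => h.
rewrite normr0 mulr0 sub0r normrN => he; rewrite distrC.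
apply: le_trans (lip h) _; apply: le_trans he; exact: ler_norm.
Qed.

End MirrorConjugate.

(** * Losses, mirror steps and the regret *)

Section Loss.
Variables (R : realType) (n1 n2 m k : nat).
Variables (B : {linear 'M[R]_(m, n2) -> 'M[R]_(n1, n2)}).
Variables (Theta : 'M[R]_(m, k)) (Psi : 'M[R]_(k, n2)).
Implicit Types (Q V : 'M[R]_(m, k)).

Let residual Q := B ((Theta - Q) *m Psi).

Definition loss_grad Q : 'M[R]_(m, k) :=
  \matrix_(i, j) - frob_inner (B (delta_mx i j *m Psi)) (residual Q).

Lemma loss_gradE Q V :
  frob_inner (loss_grad Q) V = - frob_inner (B (V *m Psi)) (residual Q).
Proof.
rewrite (@frob_inner_riesz _ _ _ (fun V => - frob_inner (B (V *m Psi)) (residual Q))) //.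
move=> c U W; rewrite mulmxDl -scalemxAl linearD linearZ /=.
by rewrite frob_innerDl frob_innerZl opprD mulrN.
Qed.

Lemma lossE Q : loss B Theta Psi Q = 2^-1 * frob_inner (residual Q) (residual Q).
Proof. by rewrite /loss /frob_norm sqr_sqrtr ?frob_inner_ge0. Qed.

Lemma residual_shift Q V : residual (Q + V) = residual Q - B (V *m Psi).
Proof. by rewrite /residual opprD addrA mulmxBl linearB. Qed.

Lemma gradient_loss Q : gradient (loss B Theta Psi) Q = loss_grad Q.
Proof.
apply: convex_gradient => [H M|V].
  have -> : M = H + (M - H) by rewrite addrC subrK.
  rewrite loss_gradE !lossE residual_shift addrAC subrr add0r.
  set b := B _; rewrite frob_innerBl !frob_innerBr (frob_innerC (residual H) b).
  have := frob_inner_ge0 b.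
  move: (frob_inner b b) (frob_inner b _) (frob_inner (residual H) _) => x y z.
  by lra.
set b := B (V *m Psi).
have -> : (fun h : R => frob_inner (loss_grad (Q + h *: V)) V) =
    (fun h => - frob_inner b (residual Q) + h * frob_inner b b).
  apply/funext => h; rewrite loss_gradE residual_shift -scalemxAl linearZ /= -/b.
  by rewrite frob_innerBr frob_innerZr opprB addrC.
apply: cvgD; first exact: cvg_cst.
by apply: cvgM; [exact: cvg_id|exact: cvg_cst].
Qed.

Lemma loss_ge0 Q : 0 <= loss B Theta Psi Q.
Proof. by rewrite lossE mulr_ge0 ?invr_ge0 ?frob_inner_ge0. Qed.

(** Euler's identity for a function that is quadratic in Theta - Q. *)
Lemma loss_gradient_pairing Q :
  frob_inner (gradient (loss B Theta Psi) Q) (Theta - Q) = - (2 * loss B Theta Psi Q).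
Proof. by rewrite gradient_loss loss_gradE lossE mulVKf. Qed.

End Loss.

Section MirrorDescent.
Variables (R : realType) (m k : nat).
Implicit Types (Q G Theta X Y : 'M[R]_(m, k)) (p : R).

Definition bregman p Theta X :=
  mirror_map p Theta - mirror_map p X - frob_inner (mirror_grad p X) (Theta - X).

Lemma bregman_ge0 p Theta X : 1 < p < 2 -> 0 <= bregman p Theta X.
Proof.
move=> p12; have := mirror_map_convex X Theta p12; rewrite /bregman.
by move: (frob_inner _ _) (mirror_map p _) (mirror_map p _) => a b c; lra.
Qed.

Lemma spectral_norm_eq0 Q : spectral_norm Q = 0 -> Q = 0.
Proof.
move=> w0; apply: frob_inner_eq0; apply/le_anti; rewrite frob_inner_ge0 andbT.
by have := frob_inner_le_spectral_norm Q; rewrite w0 expr0n mulr0.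
Qed.

(** The three-point identity, with the divergence of the step estimated by
    [bregman_smooth]. *)
Lemma mirror_step_bregman p Theta X Y G (eta : R) : 1 < p < 2 ->
  mirror_grad p Y = mirror_grad p X - eta *: G ->
  bregman p Theta Y <= bregman p Theta X + eta * frob_inner G (Theta - X) +
    eta ^+ 2 * spectral_norm G ^+ 2 / 2.
Proof.
move=> p12 step.
have := @bregman_smooth _ _ _ p G Y X eta p12.
rewrite step opprB addrC subrK => /(_ erefl).
rewrite /bregman step !frob_innerBl !frob_innerBr !frob_innerZl.
move: (eta ^+ 2 * _ / 2) (mirror_map p X) (mirror_map p Y) (mirror_map p Theta) => c x y z.
move: (frob_inner (mirror_grad p X) Theta) (frob_inner (mirror_grad p X) X).
move: (frob_inner (mirror_grad p X) Y) (frob_inner G Theta) (frob_inner G X) (frob_inner G Y).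
by move=> g1 g2 g3 g4 g5 g6; lra.
Qed.

(** The step size makes the quadratic term at most half of the linear gain.  If the
    denominator vanishes, so do the gradient and hence the loss. *)
Lemma mirror_step_loss p Theta X Y G (J e : R) : 1 < p < 2 -> 0 <= e ->
  frob_inner G (Theta - X) = - (2 * J) ->
  mirror_grad p Y = mirror_grad p X - step_size e J G *: G ->
  bregman p Theta Y <= bregman p Theta X /\
  2 * J ^+ 2 <= (bregman p Theta X - bregman p Theta Y) * step_denominator e G.
Proof.
move=> p12 e0 GJ /(mirror_step_bregman Theta p12); rewrite GJ /step_size.
set N := step_denominator e G; have NE : N = e + spectral_norm G ^+ 2 by [].
move: (bregman p Theta X) (bregman p Theta Y) => x y.
have w0 := sqr_ge0 (spectral_norm G).
have [N0|Nn0] := eqVneq N 0.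
  rewrite expr0n !mul0r !addr0 N0 mulr0 => xy; split=> //.
  have : spectral_norm G ^+ 2 = 0.
    by apply/le_anti; rewrite w0 andbT -N0 NE lerDr.
  move=> /eqP; rewrite sqrf_eq0 => /eqP/spectral_norm_eq0 G0.
  have J0 : J = 0 by move: GJ; rewrite G0 frob_inner0l; lra.
  by rewrite J0 expr0n mulr0.
have Np : 0 < N by rewrite lt_def Nn0 NE addr_ge0.
move=> step; pose a := 2 * J ^+ 2 / N.
have a0 : 0 <= a by rewrite divr_ge0 ?(ltW Np) // mulr_ge0 ?sqr_ge0.
have quad : (2 * J / N) ^+ 2 * spectral_norm G ^+ 2 / 2 <= a.
  have -> : a = (2 * J / N) ^+ 2 * N / 2 by rewrite /a; field.
  by rewrite ler_wpM2r ?invr_ge0 // ler_wpM2l ?sqr_ge0 // NE lerDr.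
have lin : 2 * J / N * - (2 * J) = - (2 * a) by rewrite /a; field.
rewrite lin in step.
have xy : a <= x - y by clear -step quad a0; lra.
split; first by rewrite -subr_ge0; exact: le_trans xy.
by rewrite -ler_pdivrMr.
Qed.

(** The choice of p gives d^(2 - 2/p) = exp (2 / p) <= e^2, and 1 / (p - 1) is
    ln d. *)
Lemma mirror_map_low_rank p d s Theta : 1 < p < 2 -> d = minn m k -> (0 < d)%N ->
  p = 1 + (ln d%:R)^-1 -> (\rank Theta <= s)%N ->
  mirror_map p Theta <=
    (expR 1 * s%:R `^ p^-1 * spectral_norm Theta) ^+ 2 * ln d%:R / 2.
Proof.
move=> p12 dE d0 pE rk; have /andP[p1 p2] := p12; have p0 : 0 < p by lra.
have lnE : ln d%:R = (p - 1)^-1 by rewrite pE addrAC subrr add0r invrK.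
have dp : 0 < d%:R :> R by rewrite ltr0n.
have pow : d%:R `^ (2 - 2 / p) <= expR 1 ^+ 2 :> R.
  rewrite -expRM_natl /powR gt_eqF // ler_expR lnE.
  have -> : (2 - 2 / p) * (p - 1)^-1 = 2 / p by field; apply/andP; split; lra.
  by rewrite mulr1 ler_pdivrMr //; lra.
rewrite mirror_mapE // /mirror_scale -dE lnE.
have -> : d%:R `^ (2 - 2 / p) / (p * (p - 1)) * (p / 2) * schatten_sum p Theta `^ (2 / p) =
  d%:R `^ (2 - 2 / p) * schatten_sum p Theta `^ (2 / p) * ((p - 1)^-1 / 2).
  by field; apply/andP; split; lra.
rewrite -[leRHS]mulrA; apply: ler_wpM2r; first by rewrite divr_ge0 // invr_ge0; lra.
rewrite !exprMn -mulrA; apply: ler_pM => //; try exact: powR_ge0.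
have -> : (s%:R `^ p^-1) ^+ 2 = s%:R `^ (2 / p) :> R.
  by rewrite -powR_mulrn ?powR_ge0 // -powRrM mulrC.
exact: schatten_sum_powR_le.
Qed.

End MirrorDescent.

(** exp (- 1/6) >= 5/6 gives e <= (6/5)^6 < 3. *)
Lemma ln3_gt1 (R : realType) : 1 < ln (3 : R).
Proof.
rewrite -ltr_expR lnK ?posrE //.
have h : expR (6^-1) <= 6 / 5 :> R.
  rewrite -[expR _]invrK -expRN -[6 / 5]invrK lef_pV2 ?posrE ?expR_gt0 ?invr_gt0 //.
  by apply: le_trans (expR_ge1Dx _); lra.
have -> : expR 1 = expR (6^-1) ^+ 6 :> R by rewrite -expRM_natl divff.
apply: (@le_lt_trans _ _ ((6 / 5) ^+ 6)); last by lra.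
by rewrite ler_pXn2r ?nnegrE ?expR_ge0 // divr_ge0.
Qed.

Lemma div_1D_inv (R : realType) (l : R) : 0 < l -> l / (1 + l) = (1 + l^-1)^-1.
Proof. by move=> l0; field; apply/andP; split; lra. Qed.

Theorem corollary6 (R : realType) (n1 n2 m k : nat)
  (hn1 : (0 < n1)%N) (hn2 : (0 < n2)%N) (hm : (0 < m)%N) (hk : (0 < k)%N)
  (d : nat) (hd : d = minn m k) (hd3 : (3 <= d)%N)
  (p : R) (hp : p = 1 + (ln d%:R)^-1)
  (A : {linear 'M[R]_(n1, n2) -> 'M[R]_(n1, n2)})
  (B : {linear 'M[R]_(m, n2) -> 'M[R]_(n1, n2)})
  (K : {linear 'M[R]_(n1, n2) -> 'M[R]_(m, n2)})
  (hABK : schur_stable (fun Y => A Y - B (K Y)))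
  (Psi : 'M[R]_(n1, n2) -> nat -> 'M[R]_(k, n2))
  (Ud : nat -> 'M[R]_(m, n2))
  (hUd : exists M : R, forall t : nat, frob_norm (Ud t) <= M)
  (Theta : 'M[R]_(m, k))
  (eps : nat -> R)
  (heps0 : forall t : nat, 0 <= eps t.+1)
  (hepsb : exists M : R, forall t : nat, eps t.+1 <= M)
  (X : nat -> 'M[R]_(n1, n2)) (U : nat -> 'M[R]_(m, n2))
  (Thetah : nat -> 'M[R]_(m, k))
  (J : nat -> 'M[R]_(m, k) -> R) (eta : nat -> R)
  (hX : forall t : nat,
     X t.+1 = A (X t) + B (Theta *m Psi (X t) t + U t))
  (hU : forall t : nat,
     U t = - K (X t) - Thetah t *m Psi (X t) t + Ud t)
  (hJ : forall t : nat, J t = loss B Theta (Psi (X t) t))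
  (heta : forall t : nat,
     eta t.+1 =
       step_size (eps t.+1) (J t (Thetah t)) (gradient (J t) (Thetah t)))
  (hTheta0 : Thetah 0%N = 0)
  (hThetaS : forall t : nat,
     Thetah t.+1 =
       gradient (fenchel_conj (mirror_map p))
         (gradient (mirror_map p) (Thetah t)
            - eta t.+1 *: gradient (J t) (Thetah t)))
  (s : nat) (hs : (0 < s)%N) (hrank : (\rank Theta <= s)%N)
  (T : nat) (hT : (1 <= T)%N) :
  \sum_(0 <= t < T) J t (Thetah t) <=
    expR 1 / 2 * s%:R `^ (ln d%:R / (1 + ln d%:R)) * spectral_norm Theta *
    Num.sqrt (ln d%:R *
      \sum_(0 <= t < T)
        step_denominator (eps t.+1) (gradient (J t) (Thetah t))).
Proof.
have d0 : (0 < d)%N by apply: leq_trans hd3.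
have ln1 : 1 < ln d%:R :> R.
  apply: lt_le_trans (ln3_gt1 R) _; rewrite ler_ln ?posrE ?ltr0n //.
  by rewrite ler_nat.
have ln0 : 0 < ln d%:R :> R by apply: lt_trans ln1.
have p12 : 1 < p < 2.
  have i0 : 0 < (ln d%:R)^-1 :> R by rewrite invr_gt0.
  have i1 : (ln d%:R)^-1 < 1 :> R by rewrite invf_lt1.
  by rewrite hp; apply/andP; split; lra.
have pV : ln d%:R / (1 + ln d%:R) = p^-1.
  by rewrite hp div_1D_inv.
pose D t := bregman p Theta (Thetah t).
pose j t := J t (Thetah t).
pose N t := step_denominator (eps t.+1) (gradient (J t) (Thetah t)).
have D0 t : 0 <= D t by exact: bregman_ge0.
have step t : D t.+1 <= D t /\ 2 * j t ^+ 2 <= (D t - D t.+1) * N t.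
  apply: mirror_step_loss => //.
    by rewrite /j hJ loss_gradient_pairing.
  rewrite hThetaS mirror_grad_fenchel // gradient_mirror_map // heta //.
have N0 t : 0 <= N t by rewrite /N /step_denominator addr_ge0 ?sqr_ge0.
have j0 t : 0 <= j t by rewrite /j hJ loss_ge0.
have tele : \sum_(0 <= t < T) (D t - D t.+1) / 2 <= D 0%N / 2.
  rewrite -mulr_suml ler_wpM2r ?invr_ge0 //.
  under eq_bigr => t _ do rewrite -opprB.
  by rewrite sumrN telescope_sumr // opprB gerBl.
have D0E : D 0%N = mirror_map p Theta.
  rewrite /D /bregman hTheta0; have /andP[p1 _] := p12.
  by rewrite mirror_map0 // mirror_grad0 // frob_inner0l !subr0.
have S0 : 0 <= \sum_(0 <= t < T) N t by apply: sumr_ge0.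
set RHS := (X in _ <= X).
have RHS0 : 0 <= RHS.
  by rewrite /RHS !mulr_ge0 ?sqrtr_ge0 ?powR_ge0 ?spectral_norm_ge0 ?expR_ge0.
rewrite -ler_sqr ?nnegrE //; last by apply: sumr_ge0 => t _; exact: j0.
have cs : (\sum_(0 <= t < T) j t) ^+ 2 <=
    (\sum_(0 <= t < T) (D t - D t.+1) / 2) * \sum_(0 <= t < T) N t.
  rewrite !big_mkord; apply: sum_cauchy => i; rewrite ?N0 //.
    by rewrite divr_ge0 // subr_ge0; case: (step i).
  by rewrite mulrAC ler_pdivlMr // mulrC; case: (step i).
apply: le_trans cs _; apply: le_trans (ler_wpM2r S0 tele) _.
rewrite D0E /RHS exprMn sqr_sqrtr; last by rewrite mulr_ge0 // ltW.
rewrite pV mulrA; apply: ler_wpM2r => //.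
have := mirror_map_low_rank p12 hd d0 hp hrank; move=> low.
have -> : (expR 1 / 2 * s%:R `^ p^-1 * spectral_norm Theta) ^+ 2 * ln d%:R =
  (expR 1 * s%:R `^ p^-1 * spectral_norm Theta) ^+ 2 * ln d%:R / 2 / 2 by field.
by rewrite ler_wpM2r ?invr_ge0.
Qed.
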